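(* Let $X=\{1,\dots,n\}$, let $T$ be a rooted binary phylogenetic tree on $X$, and let $N$ be a rooted binary phylogenetic network on $X$ with $r$ reticulations. Then $$d_{\mathrm{SNPR}}(T,N)=\min_{T'\in D(N)} d_{\mathrm{SNPR}}(T,T')+r.$$
   Context: A rooted binary phylogenetic network on $X$ is a rooted directed acyclic graph (parallel edges allowed) whose vertices are: a unique root $\rho$ of in-degree 0 and out-degree 1; leaves of in-degree 1 and out-degree 0, bijectively labelled by $X$; inner tree vertices of in-degree 1 and out-degree 2; and reticulations of in-degree 2 and out-degree 1. Tree vertices are the inner tree vertices, leaves and the root. A rooted binary phylogenetic tree is such a network with no reticulations. A directed graph $G$ has an embedding into $N$ if some subdivision of $G$ is a subgraph of $N$, with labelled vertices mapped to vertices of the same label. $N$ displays a tree $T$ on $X$ if $T$ has an embedding into $N$; $D(N)$ is the set of phylogenetic trees on $X$ displayed by $N$. For an edge $e=(u,v)$ of $N$, an SNPR operation is one of: (SNPR$^0$) if $u$ is a tree vertex, $u\ne\rho$: delete $e$, suppress $u$, subdivide an edge that is not a descendant of $v$ with a new vertex $u'$, and add $(u',v)$; (SNPR$^+$) subdivide $(u,v)$ with a new vertex $v'$, subdivide an edge of the resulting network that is not a descendant of $v'$ with a new vertex $u'$, and add $(u',v')$; (SNPR$^-$) if $u$ is a tree vertex and $v$ a reticulation: delete $e$ and suppress $u$ and $v$. The SNPR-distance $d_{\mathrm{SNPR}}(N,N')$ is the minimum length $k$ of a sequence $N=N_0,\dots,N_k=N'$ of phylogenetic networks on $X$ in which each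 $N_i$ is obtained from $N_{i-1}$ by a single SNPR operation. *)

(* Defs.v *)
From mathcomp Require Import all_boot.

Set Implicit Arguments.
Unset Strict Implicit.
Unset Printing Implicit Defensive.

(* Finite directed multigraphs (parallel edges are distinct elements of       *)
(* [edge]) with a vertex labelled rho and vertices labelled by X = 'I_n.      *)
Record lgraph (n : nat) := LGraph {
  vert : finType;
  edge : finType;
  src : edge -> vert;
  tgt : edge -> vert;
  root : vert;
  leaf : 'I_n -> vert
}.

Section Graphs.

Variable n : nat.
Implicit Types G H : lgraph n.

Definition indeg G (v : vert G) : nat := #|[set e : edge G | tgt e == v]|.

Definition outdeg G (v : vert G) : nat := #|[set e : edge G | src e == v]|.

Definition adj G : rel (vert G) :=
  fun x y => [exists e : edge G, (src e == x) && (tgt e == y)].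

(* An edge is a descendant of [v] when its tail is [v] or is reachable from   *)
(* [v] by a directed path; [connect] is reflexive.                            *)
Definition edge_descendant G (v : vert G) (e : edge G) : bool :=
  connect (@adj G) v (src e).

Definition acyclic G : Prop :=
  forall e : edge G, ~~ connect (@adj G) (tgt e) (src e).

Definition is_root G (v : vert G) : bool := (indeg v == 0) && (outdeg v == 1).

Definition is_leaf G (v : vert G) : bool := (indeg v == 1) && (outdeg v == 0).

Definition is_inner_tree_vertex G (v : vert G) : bool :=
  (indeg v == 1) && (outdeg v == 2).

Definition is_reticulation G (v : vert G) : bool :=
  (indeg v == 2) && (outdeg v == 1).

Definition is_tree_vertex G (v : vert G) : bool :=
  [|| is_inner_tree_vertex v, is_leaf v | is_root v].

Record lmorph G H := LMorph {
  vmap : vert G -> vert H;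
  emap : edge G -> edge H;
  vmap_src : forall e, vmap (src e) = src (emap e);
  vmap_tgt : forall e, vmap (tgt e) = tgt (emap e);
  vmap_root : vmap (root G) = root H;
  vmap_leaf : forall i, vmap (leaf G i) = leaf H i
}.

Definition is_iso G H (phi : lmorph G H) : Prop :=
  bijective (vmap phi) /\ bijective (emap phi).

Definition isomorphic G H : Prop := exists phi : lmorph G H, is_iso phi.

Definition is_subgraph G H : Prop :=
  exists phi : lmorph G H, injective (vmap phi) /\ injective (emap phi).

Definition delete_edge G (e : edge G) : lgraph n :=
  @LGraph n (vert G) {f : edge G | f != e}
    (fun f => src (val f)) (fun f => tgt (val f)) (root G) (leaf G).

(* The new edge is [None].                                                    *)
Definition add_edge G (u v : vert G) : lgraph n :=
  @LGraph n (vert G) (option (edge G))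
    (fun f => if f is Some f' then src f' else u)
    (fun f => if f is Some f' then tgt f' else v)
    (root G) (leaf G).

(* The new vertex is [None]; the edge [e] = (x, y) is replaced by the edges   *)
(* [Some e] = (Some x, None) and [None] = (None, Some y).                     *)
Definition subdivide G (e : edge G) : lgraph n :=
  @LGraph n (option (vert G)) (option (edge G))
    (fun f => if f is Some f' then Some (src f') else None)
    (fun f => if f is Some f' then
                if f' == e then None else Some (tgt f')
              else Some (tgt e))
    (Some (root G)) (fun i => Some (leaf G i)).

(* [H] is obtained from [G] by suppressing the vertex [u] of in-degree and    *)
(* out-degree 1: [u] is the vertex that subdivides some edge of [H]. The map  *)
(* [j] identifies the vertices of [H] with the remaining vertices of [G].     *)
Definition suppression G (u : vert G) H (j : vert H -> vert G) : Prop :=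
  exists (e : edge H) (phi : lmorph (subdivide e) G),
    [/\ is_iso phi, vmap phi None = u & forall x, vmap phi (Some x) = j x].

Inductive subdivision G : lgraph n -> Prop :=
| subdivision_refl : subdivision G G
| subdivision_step H (e : edge H) :
    subdivision G H -> subdivision G (subdivide e).

Definition has_embedding G H : Prop :=
  exists S : lgraph n, subdivision G S /\ is_subgraph S H.

(* The clause on non-root vertices makes the root the only vertex of          *)
(* in-degree 0.                                                               *)
Record is_network G : Prop := IsNetwork {
  network_acyclic : acyclic G;
  network_root : is_root (root G);
  network_leaf_inj : injective (leaf G);
  network_leaf : forall v : vert G, is_leaf v <-> exists i, leaf G i = v;
  network_vertex : forall v : vert G, v <> root G ->
    [|| is_leaf v, is_inner_tree_vertex v | is_reticulation v]
}.

End Graphs.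

Record network (n : nat) := Network {
  network_graph :> lgraph n;
  networkP : is_network network_graph
}.

Section SNPR.

Variable n : nat.
Implicit Types N T : network n.

Definition reticulation_number N : nat :=
  #|[set v : vert N | is_reticulation v]|.

Definition is_tree N : Prop := forall v : vert N, ~~ is_reticulation v.

Definition displays N T : Prop := is_tree T /\ has_embedding T N.

Definition SNPR0 N N' : Prop :=
  exists e : edge N,
    [/\ is_tree_vertex (src e), src e <> root N &
      exists (H : lgraph n) (j : vert H -> vert N) (v : vert H) (f : edge H),
        [/\ suppression (G := delete_edge e) (src e) j,
            j v = tgt e,
            ~~ edge_descendant v f &
            isomorphic (@add_edge n (subdivide f) None (Some v)) N']].

Definition SNPRplus N N' : Prop :=
  exists (e : edge N) (f : edge (subdivide e)),
    ~~ @edge_descendant n (subdivide e) None f /\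
    isomorphic (@add_edge n (subdivide f) None (Some None)) N'.

Definition SNPRminus N N' : Prop :=
  exists e : edge N,
    [/\ is_tree_vertex (src e), is_reticulation (tgt e) &
      exists (H : lgraph n) (j : vert H -> vert N) (v : vert H)
             (H' : lgraph n) (j' : vert H' -> vert H),
        [/\ suppression (G := delete_edge e) (src e) j,
            j v = tgt e,
            suppression v j' &
            isomorphic H' N']].

Definition SNPR N N' : Prop := [\/ SNPR0 N N', SNPRplus N N' | SNPRminus N N'].

(* Networks are considered up to isomorphism fixing the labels.               *)
Inductive SNPR_sequence : nat -> network n -> network n -> Prop :=
| SNPR_sequence0 N N' : isomorphic N N' -> SNPR_sequence 0 N N'
| SNPR_sequenceS k N M N' :
    SNPR N M -> SNPR_sequence k M N' -> SNPR_sequence k.+1 N N'.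

Definition is_minimum (P : nat -> Prop) (m : nat) : Prop :=
  P m /\ forall k, P k -> m <= k.

Definition is_SNPR_distance N N' : nat -> Prop :=
  is_minimum (fun k => SNPR_sequence k N N').

End SNPR.

(* Main.v *)
From mathcomp Require Import all_boot zify.
From Stdlib Require Import Classical.
Require Import Defs.

(* An embedding of a network [K] into a network [G] is the same thing as a    *)
(* colouring of edges of [G] by edges of [K] in which each colour carries a   *)
(* unit flow between the images of its endpoints: degrees at most three and   *)
(* acyclicity make the colour classes disjoint paths. These local conditions  *)
(* are stable under subdivision, suppression and deletion of uncoloured edges.*)
(*                                                                            *)
(* Upper bound: given a displayed tree [T'], a topmost reticulation has only  *)
(* tree vertices as parents and an in-edge not used by [T']; deleting it is   *)
(* inverse to an SNPR+ operation, so [T'] reaches [N] in [r] such operations. *)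
(* Lower bound: along an SNPR sequence one carries a displayed tree. An SNPR+ *)
(* preserves it, and an SNPR- or SNPR0 (an SNPR+ followed by an SNPR-) changes*)
(* it by at most one SNPR0: if the deleted in-edge of a reticulation [v] is   *)
(* used, one deletes unused in-edges of the other reticulations, which        *)
(* reduces to networks whose only reticulation is [v], where exchanging the   *)
(* two in-edges of [v] is an SNPR0. Trees are joined by SNPR0 operations that *)
(* build the pendant subtrees of the target bottom up.                        *)

Set Implicit Arguments.
Unset Strict Implicit.
Unset Printing Implicit Defensive.

Section Isomorphisms.

Variable n : nat.
Implicit Types G H K : lgraph n.

Record giso G H := GIso {
  gv : vert G -> vert H;
  ge : edge G -> edge H;
  gv' : vert H -> vert G;
  ge' : edge H -> edge G;
  gvK : cancel gv gv';
  gv'K : cancel gv' gv;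
  geK : cancel ge ge';
  ge'K : cancel ge' ge;
  gsrc : forall e, src (ge e) = gv (src e);
  gtgt : forall e, tgt (ge e) = gv (tgt e);
  groot : gv (root G) = root H;
  gleaf : forall i, gv (leaf G i) = leaf H i
}.

Lemma isomorphicP G H : isomorphic G H <-> inhabited (giso G H).
Proof.
split.
  case=> phi [[gv' K1 K2] [ge' K3 K4]]; split.
  apply: (@GIso _ _ (vmap phi) (emap phi) gv' ge') => // [e|e||i].
  - by rewrite vmap_src.
  - by rewrite vmap_tgt.
  - exact: vmap_root.
  - exact: vmap_leaf.
case=> p; have q1 e := esym (gsrc p e); have q2 e := esym (gtgt p e).
exists (LMorph q1 q2 (groot p) (gleaf p)); split; rewrite /=.
  by exists (gv' p); [exact: gvK | exact: gv'K].
by exists (ge' p); [exact: geK | exact: ge'K].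
Qed.

Definition giso_refl G : giso G G.
Proof. by apply: (@GIso _ _ id id id id). Defined.

Definition giso_sym G H (p : giso G H) : giso H G.
Proof.
apply: (@GIso _ _ (gv' p) (ge' p) (gv p) (ge p)); first exact: gv'K.
- exact: (gvK p).
- exact: (ge'K p).
- exact: (geK p).
- by move=> e; rewrite -{2}[e](ge'K p) gsrc gvK.
- by move=> e; rewrite -{2}[e](ge'K p) gtgt gvK.
- by rewrite -(groot p) gvK.
- by move=> i; rewrite -(gleaf p) gvK.
Defined.

Definition giso_trans G H K (p : giso G H) (q : giso H K) : giso G K.
Proof.
apply: (@GIso _ _ (gv q \o gv p) (ge q \o ge p)
                 (gv' p \o gv' q) (ge' p \o ge' q)) => [x|x|e|e|e|e||i] /=.
- by rewrite !gvK.
- by rewrite !gv'K.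
- by rewrite !geK.
- by rewrite !ge'K.
- by rewrite !gsrc.
- by rewrite !gtgt.
- by rewrite !groot.
- by rewrite !gleaf.
Defined.

Lemma isomorphic_refl G : isomorphic G G.
Proof. by apply/isomorphicP; split; exact: giso_refl. Qed.

Lemma isomorphic_sym G H : isomorphic G H -> isomorphic H G.
Proof.
by move=> /isomorphicP[p]; apply/isomorphicP; split; exact: giso_sym p.
Qed.

Lemma isomorphic_trans G H K :
  isomorphic G H -> isomorphic H K -> isomorphic G K.
Proof.
move=> /isomorphicP[p] /isomorphicP[q]; apply/isomorphicP; split.
exact: giso_trans p q.
Qed.

Lemma gv_inj G H (p : giso G H) : injective (gv p).
Proof. exact: can_inj (gvK p). Qed.

Lemma ge_inj G H (p : giso G H) : injective (ge p).
Proof. exact: can_inj (geK p). Qed.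

Lemma omapK (A B : Type) (f : A -> B) g : cancel f g -> cancel (omap f) (omap g).
Proof. by move=> fK [x|] //=; rewrite fK. Qed.

Definition giso_subdivide G H (p : giso G H) (e : edge G) :
  giso (subdivide e) (subdivide (ge p e)).
Proof.
apply: (@GIso (subdivide e) (subdivide (ge p e)) (omap (gv p)) (omap (ge p))
          (omap (gv' p)) (omap (ge' p))).
- exact: (omapK (gvK p)).
- exact: (omapK (gv'K p)).
- exact: (omapK (geK p)).
- exact: (omapK (ge'K p)).
- by case=> [f|] //=; rewrite gsrc.
- case=> [f|] /=; last by rewrite gtgt.
  by rewrite (inj_eq (@ge_inj _ _ p)) gtgt; case: ifP.
- by rewrite /= groot.
- by move=> i /=; rewrite gleaf.
Defined.

Definition giso_add_edge G H (p : giso G H) (u v : vert G) :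
  giso (add_edge u v) (add_edge (gv p u) (gv p v)).
Proof.
apply: (@GIso (add_edge u v) (add_edge (gv p u) (gv p v)) (gv p) (omap (ge p))
          (gv' p) (omap (ge' p))).
- exact: (gvK p).
- exact: (gv'K p).
- exact: (omapK (geK p)).
- exact: (omapK (ge'K p)).
- by case=> [f|] //=; rewrite gsrc.
- by case=> [f|] //=; rewrite gtgt.
- exact: (groot p).
- exact: (gleaf p).
Defined.

Definition graft G (f : edge G) (v : vert G) : lgraph n :=
  @add_edge n (subdivide f) None (Some v).

Definition add_reticulation G (e : edge G) (f : edge (subdivide e)) : lgraph n :=
  @graft (subdivide e) f None.

Definition giso_graft G H (p : giso G H) (f : edge G) (v : vert G) :
  giso (graft f v) (graft (ge p f) (gv p v)) :=
  giso_add_edge (giso_subdivide p f) None (Some v).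

Definition giso_add_reticulation G H (p : giso G H) (e : edge G) f :
  giso (@add_reticulation G e f)
       (@add_reticulation H (ge p e) (ge (giso_subdivide p e) f)) :=
  giso_graft (giso_subdivide p e) f None.

Definition giso_add_delete G (e : edge G) :
  giso (@add_edge n (delete_edge e) (src e) (tgt e)) G.
Proof.
pose fe (f : option {f : edge G | f != e}) := if f is Some g then val g else e.
apply: (@GIso (@add_edge n (delete_edge e) (src e) (tgt e)) G
          id fe id insub) => //.
- case=> [[f fe1]|]; rewrite /fe /=; first by rewrite insubT.
  by rewrite insubF // eqxx.
- move=> f; rewrite /fe; case: insubP => [g _ //|].
  by rewrite negbK => /eqP.
- by case.
- by case.
Defined.

Section DeleteAdd.

Variables (G H : lgraph n) (u v : vert G) (p : giso (add_edge u v) H).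

Fact delete_add_neq (f : edge G) : ge p (Some f) != ge p None.
Proof. by apply/eqP => /ge_inj. Qed.

Fact delete_add_ex (f : edge (delete_edge (ge p None))) :
  {g | ge p (Some g) = val f}.
Proof.
case E : (ge' p (val f)) => [g|]; first by exists g; rewrite -E ge'K.
by move: (valP f) => /eqP; case; rewrite -[LHS](ge'K p) E.
Qed.

Definition giso_delete_add : giso G (delete_edge (ge p None)).
Proof.
apply: (@GIso G (delete_edge (ge p None)) (gv p)
          (fun f => exist _ (ge p (Some f)) (delete_add_neq f)) (gv' p)
          (fun f => sval (delete_add_ex f))).
- exact: (gvK p).
- exact: (gv'K p).
- by move=> f; case: (delete_add_ex _) => g /= /ge_inj [].
- by move=> f; apply: val_inj => /=; case: (delete_add_ex f).
- by move=> f /=; rewrite gsrc.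
- by move=> f /=; rewrite gtgt.
- exact: (groot p).
- exact: (gleaf p).
Defined.

End DeleteAdd.

End Isomorphisms.

Section Connectivity.

Variable n : nat.
Implicit Types G H K : lgraph n.

Lemma adj_edge G (e : edge G) : adj (src e) (tgt e).
Proof. by apply/existsP; exists e; rewrite !eqxx. Qed.

Lemma adjP G (x y : vert G) :
  reflect (exists2 e : edge G, src e = x & tgt e = y) (adj x y).
Proof.
apply: (iffP existsP) => [[e /andP[/eqP h1 /eqP h2]]|[e <- <-]].
  by exists e.
by exists e; rewrite !eqxx.
Qed.

Lemma connect_edge G (e : edge G) : connect (@adj n G) (src e) (tgt e).
Proof. exact/connect1/adj_edge. Qed.

Lemma connect_ind_l (V : finType) (r : rel V) (P : V -> Prop) y :
  P y -> (forall x z, r x z -> connect r z y -> P z -> P x) ->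
  forall x, connect r x y -> P x.
Proof.
move=> Py Pr x /connectP[p]; elim: p x => [|z p IH] x /=; first by move=> _ <-.
move=> /andP[rxz pz] ey; apply: (Pr _ z) => //; first by apply/connectP; exists p.
exact: IH.
Qed.

Lemma connect_homo G H (h : vert G -> vert H) :
  (forall e : edge G, connect (@adj n H) (h (src e)) (h (tgt e))) ->
  forall x y, connect (@adj n G) x y -> connect (@adj n H) (h x) (h y).
Proof.
move=> hh x y; move: x; apply: connect_ind_l => // x z /adjP[e <- <-] _ c.
exact: connect_trans c.
Qed.

Lemma connect_giso G H (p : giso G H) x y :
  connect (@adj n H) (gv p x) (gv p y) = connect (@adj n G) x y.
Proof.
apply/idP/idP => [|c].
  rewrite -{2}(gvK p x) -{2}(gvK p y).
  apply: connect_homo => e.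
  by have := connect_edge (ge (giso_sym p) e); rewrite gsrc gtgt.
by move: c; apply: connect_homo => e; rewrite -gsrc -gtgt; exact: connect_edge.
Qed.

Lemma acyclic_giso G H (p : giso G H) : acyclic G -> acyclic H.
Proof.
move=> aG e; rewrite -(ge'K p e) gsrc gtgt connect_giso; exact: aG.
Qed.

Lemma connect_subdivide G (e : edge G) x y :
  connect (@adj n (subdivide e)) (Some x) (Some y) = connect (@adj n G) x y.
Proof.
apply/idP/idP.
  pose h (z : vert (subdivide e)) := if z is Some z' then z' else src e.
  move=> c; suff : connect (@adj n G) (h (Some x)) (h (Some y)) by [].
  move: c; apply: connect_homo => -[f|] /=; last exact: connect_edge.
  by case: eqP => [->//|_] /=; exact: connect_edge.
apply: (@connect_homo G (subdivide e) some) => f.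
case: (eqVneq f e) => [->|ne].
  apply: (@connect_trans _ _ None).
    by have := @connect_edge (subdivide e) (Some e); rewrite /= eqxx.
  exact: (@connect_edge (subdivide e) None).
by have := @connect_edge (subdivide e) (Some f); rewrite /= (negPf ne).
Qed.

Lemma connect_subdivide_NS G (e : edge G) y :
  connect (@adj n (subdivide e)) None (Some y) = connect (@adj n G) (tgt e) y.
Proof.
apply/idP/idP.
  pose h (z : vert (subdivide e)) := if z is Some z' then z' else tgt e.
  move=> c; suff : connect (@adj n G) (h None) (h (Some y)) by [].
  move: c; apply: connect_homo => -[f|] //=.
  by case: eqP => [->|_] /=; exact: connect_edge.
rewrite -(connect_subdivide e); apply: connect_trans.
exact: (@connect_edge (subdivide e) None).
Qed.

Lemma connect_subdivide_SN G (e : edge G) x :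
  connect (@adj n (subdivide e)) (Some x) None = connect (@adj n G) x (src e).
Proof.
apply/idP/idP.
  pose h (z : vert (subdivide e)) := if z is Some z' then z' else src e.
  move=> c; suff : connect (@adj n G) (h (Some x)) (h None) by [].
  move: c; apply: connect_homo => -[f|] //=; last exact: connect_edge.
  by case: eqP => [->|_] //=; exact: connect_edge.
rewrite -(connect_subdivide e) => c; apply: connect_trans c _.
by have := @connect_edge (subdivide e) (Some e); rewrite /= eqxx.
Qed.

Lemma acyclic_subdivide G (e : edge G) : acyclic (subdivide e) <-> acyclic G.
Proof.
split=> a f.
  case: (eqVneq f e) => [->|ne].
    by have := a None; rewrite /= connect_subdivide_SN.
  by have := a (Some f); rewrite /= (negPf ne) connect_subdivide.
case: f => [f|] /=; last by rewrite connect_subdivide_SN.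
case: eqP => [->|_]; first by rewrite connect_subdivide_NS.
by rewrite connect_subdivide.
Qed.

Lemma connect_add_edge G (u v x y : vert G) :
  connect (@adj n (add_edge u v)) x y =
  connect (@adj n G) x y || (connect (@adj n G) x u && connect (@adj n G) v y).
Proof.
have sub : forall a b, connect (@adj n G) a b ->
    connect (@adj n (add_edge u v)) a b.
  apply: (@connect_homo G (add_edge u v) id) => e.
  exact: (@connect_edge (add_edge u v) (Some e)).
apply/idP/idP.
  move: x; apply: connect_ind_l => [|x z /adjP[e e1 e2] _]; first by rewrite connect0.
  case: e e1 e2 => [e|] /= <- <-.
    case/orP => [c|/andP[c1 c2]].
      by rewrite (connect_trans (connect_edge e) c).
    by rewrite (connect_trans (connect_edge e) c1) c2 orbT.
  case/orP => [c|/andP[c1 c2]]; first by rewrite c connect0 orbT.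
  by rewrite connect0 c2 orbT.
case/orP => [/sub //|/andP[/sub c1 /sub c2]].
apply: connect_trans c1 (connect_trans _ c2).
exact: (@connect_edge (add_edge u v) None).
Qed.

Lemma acyclic_add_edge G (u v : vert G) :
  acyclic (add_edge u v) <-> acyclic G /\ ~~ connect (@adj n G) v u.
Proof.
split=> [a|[a nc] [e|] /=].
- split=> [e|]; first by have := a (Some e); rewrite /= connect_add_edge => /norP[].
  by have := a None; rewrite /= connect_add_edge => /norP[].
- rewrite connect_add_edge (negPf (a e)) /=; apply/andP => -[c1 c2].
  move/negP: nc; apply.
  exact: connect_trans (connect_trans c2 (connect_edge e)) c1.
- by rewrite connect_add_edge (negPf nc).
Qed.

Lemma acyclic_graft G (f : edge G) (v : vert G) :
  acyclic (graft f v) <-> acyclic G /\ ~~ connect (@adj n G) v (src f).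
Proof. by rewrite acyclic_add_edge acyclic_subdivide connect_subdivide_SN. Qed.

End Connectivity.

Section Degrees.

Variable n : nat.
Implicit Types G H K : lgraph n.

Lemma sum_option (T : finType) (F : option T -> nat) :
  \sum_x F x = F None + \sum_x F (Some x).
Proof.
rewrite (bigD1 None) //=; congr (_ + _).
rewrite (reindex_omap Some id) /=; last by case.
by apply: eq_bigl => x; rewrite eqxx.
Qed.

Lemma sum_pick (T : finType) (F : T -> nat) a :
  \sum_x (x == a) * F x = F a.
Proof.
rewrite (bigD1 a) //= eqxx mul1n big1 ?addn0 // => x /negPf ->.
by rewrite mul0n.
Qed.

Lemma indegE G (v : vert G) : indeg v = \sum_(e : edge G) (tgt e == v).
Proof. by rewrite /indeg cardsE -sum1_card big_mkcond /=; apply: eq_bigr. Qed.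

Lemma outdegE G (v : vert G) : outdeg v = \sum_(e : edge G) (src e == v).
Proof. by rewrite /outdeg cardsE -sum1_card big_mkcond /=; apply: eq_bigr. Qed.

Lemma indeg_giso G H (p : giso G H) x : indeg (gv p x) = indeg x.
Proof.
rewrite !indegE (reindex (ge p)) /=; last first.
  by exists (ge' p) => e _; [exact: geK | exact: ge'K].
by apply: eq_bigr => e _; rewrite gtgt (inj_eq (@gv_inj _ _ _ p)).
Qed.

Lemma outdeg_giso G H (p : giso G H) x : outdeg (gv p x) = outdeg x.
Proof.
rewrite !outdegE (reindex (ge p)) /=; last first.
  by exists (ge' p) => e _; [exact: geK | exact: ge'K].
by apply: eq_bigr => e _; rewrite gsrc (inj_eq (@gv_inj _ _ _ p)).
Qed.

Lemma indeg_subdivide G (e : edge G) x :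
  @indeg n (subdivide e) (Some x) = indeg x.
Proof.
rewrite !indegE sum_option /= [in RHS](bigD1 e) //= [in LHS](bigD1 e) //= eqxx.
by congr (_ + _); apply: eq_bigr => f /negPf ->.
Qed.

Lemma outdeg_subdivide G (e : edge G) x :
  @outdeg n (subdivide e) (Some x) = outdeg x.
Proof. by rewrite !outdegE sum_option. Qed.

Lemma indeg_subdivide_new G (e : edge G) : @indeg n (subdivide e) None = 1.
Proof.
rewrite indegE sum_option /= (bigD1 e) //= eqxx big1 // => f /negPf -> //.
Qed.

Lemma outdeg_subdivide_new G (e : edge G) : @outdeg n (subdivide e) None = 1.
Proof. by rewrite outdegE sum_option /= big1. Qed.

Lemma indeg_add_edge G (u v x : vert G) :
  @indeg n (add_edge u v) x = (v == x) + indeg x.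
Proof. by rewrite !indegE sum_option. Qed.

Lemma outdeg_add_edge G (u v x : vert G) :
  @outdeg n (add_edge u v) x = (u == x) + outdeg x.
Proof. by rewrite !outdegE sum_option. Qed.

Section Graft.

Variables (G : lgraph n) (f : edge G) (v : vert G).

Lemma indeg_graft x : @indeg n (graft f v) (Some x) = (v == x) + indeg x.
Proof. by rewrite indeg_add_edge indeg_subdivide. Qed.

Lemma outdeg_graft x : @outdeg n (graft f v) (Some x) = outdeg x.
Proof. by rewrite outdeg_add_edge outdeg_subdivide. Qed.

Lemma indeg_graft_new : @indeg n (graft f v) None = 1.
Proof. by rewrite indeg_add_edge indeg_subdivide_new. Qed.

Lemma outdeg_graft_new : @outdeg n (graft f v) None = 2.
Proof. by rewrite outdeg_add_edge outdeg_subdivide_new. Qed.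

End Graft.

Section AddReticulation.

Variables (G : lgraph n) (e : edge G) (f : edge (subdivide e)).

Lemma indeg_add_reticulation x :
  @indeg n (add_reticulation f) (Some (Some x)) = indeg x.
Proof. by rewrite indeg_graft indeg_subdivide. Qed.

Lemma outdeg_add_reticulation x :
  @outdeg n (add_reticulation f) (Some (Some x)) = outdeg x.
Proof. by rewrite outdeg_graft outdeg_subdivide. Qed.

Lemma retic_add_reticulation :
  @is_reticulation n (add_reticulation f) (Some None).
Proof.
by rewrite /is_reticulation indeg_graft outdeg_graft indeg_subdivide_new
  outdeg_subdivide_new.
Qed.

Lemma inner_add_reticulation :
  @is_inner_tree_vertex n (add_reticulation f) None.
Proof. by rewrite /is_inner_tree_vertex indeg_graft_new outdeg_graft_new. Qed.

End AddReticulation.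

Record network_degrees G : Prop := NetworkDegrees {
  nd_root : is_root (root G);
  nd_leaf_inj : injective (leaf G);
  nd_leaf : forall v : vert G, is_leaf v <-> exists i, leaf G i = v;
  nd_vertex : forall v : vert G, v <> root G ->
    [|| is_leaf v, is_inner_tree_vertex v | is_reticulation v]
}.

Lemma is_networkE G : is_network G <-> acyclic G /\ network_degrees G.
Proof. by split=> [[a b c d e]|[a [b c d e]]]; split. Qed.

Section DegreePreservingMap.

Variables (G H : lgraph n) (h : vert G -> vert H).
Hypotheses (h_inj : injective h)
  (h_in : forall x, indeg (h x) = indeg x)
  (h_out : forall x, outdeg (h x) = outdeg x)
  (h_root : h (root G) = root H) (h_leaf : forall i, h (leaf G i) = leaf H i)
  (h_new : forall y, (exists x, y = h x) \/
    (is_inner_tree_vertex y || is_reticulation y)).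

Lemma network_degrees_map : network_degrees G <-> network_degrees H.
Proof.
split=> -[rt li lf vx]; split.
- by rewrite -h_root /is_root h_in h_out.
- by move=> i j; rewrite -!h_leaf => /h_inj; exact: li.
- move=> v; split.
    case: (h_new v) => [[x ->]|]; last first.
      by rewrite /is_leaf /is_inner_tree_vertex /is_reticulation; lia.
    rewrite /is_leaf h_in h_out => /lf [i <-]; exists i; exact/esym/h_leaf.
  case=> i <-; rewrite -h_leaf /is_leaf h_in h_out; apply/lf; by exists i.
- move=> v nv; case: (h_new v) => [[x ev]|->]; last by rewrite orbT.
  rewrite ev /is_leaf /is_inner_tree_vertex /is_reticulation h_in h_out.
  by apply: vx => ex; apply: nv; rewrite ev ex.
- by move: rt; rewrite -h_root /is_root h_in h_out.
- by move=> i j ij; apply: li; rewrite -!h_leaf ij.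
- move=> v; have := lf (h v); rewrite /is_leaf h_in h_out => ->.
  split=> -[i ei]; exists i; first by apply: h_inj; rewrite h_leaf.
  by rewrite -h_leaf ei.
- move=> v nv; have := vx (h v).
  rewrite /is_leaf /is_inner_tree_vertex /is_reticulation h_in h_out; apply.
  by rewrite -h_root => /h_inj.
Qed.

End DegreePreservingMap.

Lemma is_network_giso G H : giso G H -> is_network G -> is_network H.
Proof.
move=> p /is_networkE[a d]; apply/is_networkE; split.
  exact: (acyclic_giso p a).
apply: (proj1 (network_degrees_map (h := gv p) _ _ _ _ _ _)) d.
- exact: (@gv_inj _ _ _ p).
- exact: (indeg_giso p).
- exact: (outdeg_giso p).
- exact: (groot p).
- exact: (gleaf p).
- by move=> y; left; exists (gv' p y); rewrite gv'K.
Qed.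

Lemma network_degrees_graft G (f f' : edge G) (v : vert G) :
  network_degrees (graft f v) -> network_degrees (graft f' v).
Proof.
apply: (proj1 (@network_degrees_map (graft f v) (graft f' v) id _ _ _ _ _ _)) => //.
- case=> [x|]; first by rewrite !indeg_graft.
  by rewrite !indeg_graft_new.
- by move=> y; left; exists y.
Qed.

Lemma is_network_graft G (f f' : edge G) (v : vert G) :
  is_network (graft f v) -> ~~ connect (@adj n G) v (src f') ->
  is_network (graft f' v).
Proof.
move=> /is_networkE[/acyclic_graft[a _] d] nc; apply/is_networkE.
by split; [apply/acyclic_graft | exact: network_degrees_graft d].
Qed.

Lemma network_degrees_add_reticulation G (e : edge G) f :
  network_degrees (@add_reticulation n G e f) <-> network_degrees G.
Proof.
symmetry.
apply: (@network_degrees_map G (add_reticulation f) (Some \o Some)) => //.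
- by move=> x y [].
- exact: indeg_add_reticulation.
- exact: outdeg_add_reticulation.
- case=> [[x|]|]; first by left; exists x.
    by right; rewrite retic_add_reticulation orbT.
  by right; rewrite inner_add_reticulation.
Qed.

Lemma is_network_add_reticulation G (e : edge G) f :
  is_network (@add_reticulation n G e f) <->
  is_network G /\ ~~ @edge_descendant n (subdivide e) None f.
Proof.
rewrite !is_networkE network_degrees_add_reticulation acyclic_graft.
rewrite acyclic_subdivide /edge_descendant; tauto.
Qed.

End Degrees.

Section NetworkFacts.

Variable n : nat.
Implicit Types G H K : lgraph n.

Lemma sum_pred1_nat (T : finType) (a : T) : \sum_x (a == x) = 1.
Proof.
rewrite (bigD1 a) //= eqxx big1 // => x /negPf; by rewrite eq_sym => ->.
Qed.

Lemma sum1_vert G : \sum_(v : vert G) 1 = #|vert G|.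
Proof. by rewrite sum1_card. Qed.

Lemma sum_indeg G : \sum_(v : vert G) indeg v = #|edge G|.
Proof.
under eq_bigr => v _ do rewrite indegE.
by rewrite exchange_big /=; under eq_bigr => e _ do rewrite sum_pred1_nat;
  rewrite sum1_card.
Qed.

Lemma sum_outdeg G : \sum_(v : vert G) outdeg v = #|edge G|.
Proof.
under eq_bigr => v _ do rewrite outdegE.
by rewrite exchange_big /=; under eq_bigr => e _ do rewrite sum_pred1_nat;
  rewrite sum1_card.
Qed.

Lemma vertex_kind G (v : vert G) : is_network G ->
  [\/ v = root G /\ is_root v, is_leaf v, is_inner_tree_vertex v |
      is_reticulation v].
Proof.
move=> nG; case: (eqVneq v (root G)) => [->|/eqP nv].
  by apply: Or41; split=> //; exact: network_root nG.
by case/or3P: (network_vertex nG nv); [exact: Or42|exact: Or43|exact: Or44].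
Qed.

Lemma card_leaves G : is_network G -> #|[set v : vert G | is_leaf v]| = n.
Proof.
move=> nG; rewrite -[RHS]card_ord -(card_imset _ (network_leaf_inj nG)).
apply: eq_card => v; rewrite !inE; apply/idP/imsetP.
  by case/(network_leaf nG) => i <-; exists i.
by case=> i _ ->; apply/(network_leaf nG); exists i.
Qed.

Lemma card_vert (N : network n) :
  #|vert N| = 2 * (n + reticulation_number N).
Proof.
have nN := networkP N.
have L : \sum_(v : vert N) is_leaf v = n.
  by rewrite -[RHS](card_leaves nN) -sum1dep_card [RHS]big_mkcond; apply: eq_bigr.
have R : \sum_(v : vert N) is_reticulation v = reticulation_number N.
  by rewrite /reticulation_number -sum1dep_card [RHS]big_mkcond; apply: eq_bigr.
suff : \sum_(v : vert N) (1 + indeg v) =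
       \sum_(v : vert N) (outdeg v + (is_leaf v + is_leaf v) +
         (is_reticulation v + is_reticulation v)).
  rewrite !big_split /= sum_indeg sum_outdeg sum1_vert L R.
  by move: #|edge N| #|vert N| (reticulation_number N) => a b c; lia.
apply: eq_bigr => v _.
by case: (vertex_kind v nN) => [[_]|||];
  rewrite /is_root /is_leaf /is_inner_tree_vertex /is_reticulation;
  move=> /andP[/eqP -> /eqP ->].
Qed.

Lemma card_edge (N : network n) :
  (#|edge N|).+1 = #|vert N| + reticulation_number N.
Proof.
have nN := networkP N.
have R : \sum_(v : vert N) is_reticulation v = reticulation_number N.
  by rewrite /reticulation_number -sum1dep_card [RHS]big_mkcond; apply: eq_bigr.
suff : \sum_(v : vert N) (indeg v + (root N == v)) =
       \sum_(v : vert N) (1 + is_reticulation v).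
  rewrite !big_split /= sum_indeg sum_pred1_nat sum1_vert R.
  by move: #|edge N| #|vert N| (reticulation_number N) => a b c; lia.
apply: eq_bigr => v _; case: eqP => [<-|/eqP nv].
  have := network_root nN; rewrite /is_root /is_reticulation.
  by move=> /andP[/eqP -> /eqP ->].
case: (vertex_kind v nN) => [[ev _]|||]; first by rewrite ev eqxx in nv.
all: rewrite /is_leaf /is_inner_tree_vertex /is_reticulation.
all: by move=> /andP[/eqP -> /eqP ->].
Qed.

Lemma reticulation_number_add (N N' : network n) (e : edge N) f :
  giso (@add_reticulation n N e f) N' ->
  reticulation_number N' = (reticulation_number N).+1.
Proof.
move=> p; have := card_vert N'; have := card_vert N.
have <- : #|vert (add_reticulation f)| = #|vert N'|.
  exact: bij_eq_card (Bijective (gvK p) (gv'K p)).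
rewrite !card_option; lia.
Qed.

Lemma tree_reticulation_number (N : network n) :
  is_tree N <-> reticulation_number N = 0.
Proof.
rewrite /reticulation_number; split=> [t|/eqP].
  by apply/eqP; rewrite cards_eq0; apply/eqP/setP => v; rewrite !inE (negPf (t v)).
by rewrite cards_eq0 => /eqP/setP e v; move: (e v); rewrite !inE => ->.
Qed.

Lemma outdeg_gt0 G (e : edge G) : 0 < outdeg (src e).
Proof. by apply/card_gt0P; exists e; rewrite inE. Qed.

Lemma indeg_gt0 G (e : edge G) : 0 < indeg (tgt e).
Proof. by apply/card_gt0P; exists e; rewrite inE. Qed.

Lemma indeg_gt0P G (v : vert G) :
  reflect (exists e : edge G, tgt e = v) (0 < indeg v).
Proof.
apply: (iffP card_gt0P) => -[e]; first by rewrite inE => /eqP; exists e.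
by exists e; rewrite inE; apply/eqP.
Qed.

Lemma outdeg_gt0P G (v : vert G) :
  reflect (exists e : edge G, src e = v) (0 < outdeg v).
Proof.
apply: (iffP card_gt0P) => -[e]; first by rewrite inE => /eqP; exists e.
by exists e; rewrite inE; apply/eqP.
Qed.

Lemma indeg1_inj G (e f : edge G) :
  indeg (tgt e) <= 1 -> tgt f = tgt e -> f = e.
Proof.
move=> /card_le1_eqP h ef; by apply: h; rewrite inE ?ef eqxx.
Qed.

Lemma outdeg1_inj G (e f : edge G) :
  outdeg (src e) <= 1 -> src f = src e -> f = e.
Proof.
move=> /card_le1_eqP h ef; by apply: h; rewrite inE ?ef eqxx.
Qed.

Lemma indeg_gt1P G (v : vert G) :
  reflect (exists e f : edge G, [/\ e != f, tgt e = v & tgt f = v]) (1 < indeg v).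
Proof.
apply: (iffP card_gt1P) => -[e [f]].
  by rewrite !inE => -[/eqP h1 /eqP h2 h3]; exists e, f.
by case=> h1 h2 h3; exists e, f; rewrite !inE h2 h3.
Qed.

Lemma outdeg_gt1P G (v : vert G) :
  reflect (exists e f : edge G, [/\ e != f, src e = v & src f = v]) (1 < outdeg v).
Proof.
apply: (iffP card_gt1P) => -[e [f]].
  by rewrite !inE => -[/eqP h1 /eqP h2 h3]; exists e, f.
by case=> h1 h2 h3; exists e, f; rewrite !inE h2 h3.
Qed.

Lemma acyclic_loop G (e : edge G) : acyclic G -> src e != tgt e.
Proof. by move=> a; apply: contra (a e) => /eqP ->. Qed.

Section Suppress.

Variables (G : lgraph n) (u : vert G) (a b : edge G).
Hypotheses (u_root : root G != u) (u_leaf : forall i, leaf G i != u)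
  (ta : tgt a = u) (sb : src b = u) (sa : src a != u) (tb : tgt b != u)
  (ta_uniq : forall f, tgt f = u -> f = a)
  (sb_uniq : forall f, src f = u -> f = b).

Let W := {x : vert G | x != u}.
Let w0 : W := exist _ (root G) u_root.

Definition suppress : lgraph n :=
  @LGraph n W {f : edge G | f != b}
    (fun f => insubd w0 (src (val f)))
    (fun f => insubd w0 (if val f == a then tgt b else tgt (val f)))
    w0 (fun i => exist _ (leaf G i) (u_leaf i)).

Let ab : a != b.
Proof. by apply: contra sa => /eqP ->; rewrite sb. Qed.

Definition merged_edge : edge suppress := exist _ a ab.

Definition giso_suppress : giso (subdivide merged_edge) G.
Proof.
pose fv (x : option W) := if x is Some y then val y else u.
pose fe (f : option {f : edge G | f != b}) := if f is Some g then val g else b.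
apply: (@GIso _ (subdivide merged_edge) G fv fe insub insub).
- by case=> [x|]; rewrite /fv /= ?valK // insubF // eqxx.
- move=> x; rewrite /fv; case: insubP => [y _ //|]; by rewrite negbK => /eqP.
- by case=> [x|]; rewrite /fe /= ?valK // insubF // eqxx.
- move=> x; rewrite /fe; case: insubP => [y _ //|]; by rewrite negbK => /eqP.
- case=> [f|] //=; rewrite val_insubd.
  by case: eqP => // /sb_uniq e; move: (valP f); rewrite /= e eqxx.
- case=> [f|] /=; last by rewrite val_insubd eqxx tb.
  rewrite -(inj_eq val_inj) /=; case: eqP => [->|ne] /=; first exact: ta.
  by rewrite val_insubd; case: eqP => // /ta_uniq.
- by [].
- by [].
Defined.

End Suppress.

Lemma exists_suppression G (u : vert G) :
  acyclic G -> indeg u = 1 -> outdeg u = 1 -> root G <> u ->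
  (forall i, leaf G i <> u) ->
  exists (H : lgraph n) (e : edge H) (p : giso (subdivide e) G), gv p None = u.
Proof.
move=> ac i1 o1 /eqP nr nl.
have /indeg_gt0P[a ta] : 0 < indeg u by rewrite i1.
have /outdeg_gt0P[b sb] : 0 < outdeg u by rewrite o1.
have nl' i : leaf G i != u by apply/eqP.
have sa : src a != u by rewrite -ta; exact: acyclic_loop.
have tb : tgt b != u by rewrite -sb eq_sym; exact: acyclic_loop.
have au f : tgt f = u -> f = a by rewrite -ta; apply: indeg1_inj; rewrite ta i1.
have bu f : src f = u -> f = b by rewrite -sb; apply: outdeg1_inj; rewrite sb o1.
by exists (suppress a b nr nl'), (merged_edge nr nl' sb sa),
  (giso_suppress nr nl' ta sb sa tb au bu).
Qed.

Lemma graft_decomposition G (e : edge G) :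
  is_network G -> is_inner_tree_vertex (src e) ->
  exists (H : lgraph n) (f : edge H) (v : vert H) (p : giso (graft f v) G),
    ge p None = e.
Proof.
move=> nG /andP[/eqP i1 /eqP o2].
have ac := network_acyclic nG.
have lp := acyclic_loop e ac.
pose D := delete_edge e.
have aD : acyclic D.
  have := acyclic_giso (giso_sym (giso_add_delete e)) ac.
  by case/acyclic_add_edge.
have iD : @indeg n D (src e) = 1.
  have := indeg_giso (giso_add_delete e) (src e).
  by rewrite indeg_add_edge [gv _ _]/= i1 eq_sym (negPf lp).
have oD : @outdeg n D (src e) = 1.
  have := outdeg_giso (giso_add_delete e) (src e).
  by rewrite outdeg_add_edge eqxx [gv _ _]/= o2 => -[].
have nr : root D <> src e.
  move=> er; have := network_root nG; rewrite /is_root.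
  by rewrite (er : root G = src e) i1.
have nl i : leaf D i <> src e.
  move=> el; have /(network_leaf nG) : exists i, leaf G i = src e by exists i.
  by rewrite /is_leaf o2 andbF.
have [H [f [p pN]]] := exists_suppression aD iD oD nr nl.
case Ev : (gv' p (tgt e)) => [v|]; last first.
  by move: lp; rewrite -pN -Ev gv'K eqxx.
have pv : gv p (Some v) = tgt e by rewrite -Ev gv'K.
suff [q qN] : exists q : giso (graft f v) (@add_edge n D (src e) (tgt e)),
    ge q None = None.
  by exists H, f, v, (giso_trans q (giso_add_delete e)); rewrite /= qN.
by rewrite -pN -pv; exists (giso_add_edge p None (Some v)).
Qed.

Lemma add_reticulation_decomposition G (e : edge G) :
  is_network G -> is_inner_tree_vertex (src e) -> is_reticulation (tgt e) ->
  exists (N : network n) (d : edge N) f (p : giso (@add_reticulation n N d f) G),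
    ge p None = e.
Proof.
move=> nG si /andP[/eqP i2 /eqP o1].
have [H [f [v [p pN]]]] := graft_decomposition nG si.
have pv : gv p (Some v) = tgt e by rewrite -pN gtgt.
have nA : is_network (graft f v) := is_network_giso (giso_sym p) nG.
have [aH _] := proj1 (acyclic_graft f v) (network_acyclic nA).
have iv : indeg v = 1.
  by move: i2; rewrite -pv indeg_giso indeg_graft eqxx => -[].
have ov : outdeg v = 1 by move: o1; rewrite -pv outdeg_giso outdeg_graft.
have nr : root H <> v.
  move=> er; have /andP[/eqP] := network_root nA.
  by rewrite /= er indeg_graft eqxx.
have nl i : leaf H i <> v.
  move=> el; have /(network_leaf nA) : exists i, leaf (graft f v) i = Some v.
    by exists i; rewrite /= el.
  by rewrite /is_leaf outdeg_graft ov andbF.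
have [K [d [q qN]]] := exists_suppression aH iv ov nr nl.
have [q' q'N] : exists q' : giso (@graft n (subdivide d) (ge' q f) None)
    (graft f v), ge q' None = None.
  rewrite -[in graft f v](ge'K q f) -qN.
  by exists (giso_graft q (ge' q f) None).
pose r := giso_trans q' p.
have nK : is_network (@add_reticulation n K d (ge' q f)) :=
  is_network_giso (giso_sym r) nG.
have [nK' _] := proj1 (is_network_add_reticulation _) nK.
by exists (Network nK'), d, (ge' q f), r; rewrite /= q'N.
Qed.

End NetworkFacts.

Section Flows.

Variable n : nat.
Implicit Types G H K S : lgraph n.

(* The edges of colour [a] carry a unit flow from [fv (src a)] to             *)
(* [fv (tgt a)]; in an acyclic graph they form a path, so a flow is an        *)
(* embedding up to edges that can be uncoloured.                              *)
Record flow K G := Flow {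
  fv : vert K -> vert G;
  fc : edge G -> option (edge K);
  fv_inj : injective fv;
  fv_root : fv (root K) = root G;
  fv_leaf : forall i, fv (leaf K i) = leaf G i;
  fcons : forall a x,
    \sum_g (fc g == Some a) * (src g == x) + (fv (tgt a) == x) =
    \sum_g (fc g == Some a) * (tgt g == x) + (fv (src a) == x)
}.

Lemma sum_colour K G (c : edge G -> option (edge K)) (F : edge G -> nat)
    (W : edge K -> nat) :
  \sum_g (if c g is Some a then W a else 0) * F g =
  \sum_a W a * \sum_g (c g == Some a) * F g.
Proof.
under [RHS]eq_bigr => a _ do rewrite big_distrr /=.
rewrite [RHS]exchange_big /=; apply: eq_bigr => g _.
case: (c g) => [a|]; last by rewrite big1 // => b _; rewrite mul0n muln0.
rewrite (bigD1 a) //= eqxx mul1n big1 ?addn0 // => b /negPf ne.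
by rewrite (inj_eq (@Some_inj _)) eq_sym ne mul0n muln0.
Qed.

Lemma sum_fibre (V W : finType) (h : V -> W) y x :
  \sum_z (h z == x) * (y == z) = (h y == x).
Proof.
rewrite (bigD1 y) //= eqxx muln1 big1 ?addn0 // => z /negPf ne.
by rewrite (eq_sym y) ne muln0.
Qed.

Definition flow_comp K H G (p : flow K H) (q : flow H G) : flow K G.
Proof.
apply: (@Flow K G (fv q \o fv p) (fun g => obind (fc p) (fc q g))).
- by move=> x y /= /(@fv_inj _ _ q) /(@fv_inj _ _ p).
- by rewrite /= !fv_root.
- by move=> i; rewrite /= !fv_leaf.
move=> a x; pose W h : nat := fc p h == Some a.
have E (F : edge G -> nat) : \sum_g (obind (fc p) (fc q g) == Some a) * F g =
    \sum_h W h * \sum_g (fc q g == Some h) * F g.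
  by rewrite -sum_colour; apply: eq_bigr => g _; case: (fc q g).
rewrite !E.
have E1 : \sum_h W h * \sum_g (fc q g == Some h) * (src g == x) +
          \sum_h W h * (fv q (tgt h) == x) =
          \sum_h W h * \sum_g (fc q g == Some h) * (tgt g == x) +
          \sum_h W h * (fv q (src h) == x).
  rewrite -!big_split /=; apply: eq_bigr => h _.
  by rewrite -!mulnDr fcons.
have E2 : \sum_h W h * (fv q (src h) == x) + (fv q (fv p (tgt a)) == x) =
          \sum_h W h * (fv q (tgt h) == x) + (fv q (fv p (src a)) == x).
  pose S (t : edge H -> vert H) := 
    \sum_y (fv q y == x) * \sum_h W h * (t h == y).
  have ES t : \sum_h W h * (fv q (t h) == x) = S t.
    rewrite /S; under [RHS]eq_bigr => y _ do rewrite big_distrr /=.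
    rewrite [RHS]exchange_big /=; apply: eq_bigr => h _.
    under [RHS]eq_bigr => y _ do rewrite mulnCA.
    by rewrite -big_distrr /= sum_fibre.
  rewrite !ES /S -(sum_fibre _ (fv p (tgt a))).
  rewrite -(sum_fibre _ (fv p (src a))) -!big_split /=.
  by apply: eq_bigr => y _; rewrite -!mulnDr fcons.
move: E1 E2 => /=; lia.
Defined.

Lemma flow_compE K H G (p : flow K H) (q : flow H G) g h :
  fc q g = Some h -> fc (flow_comp p q) g = fc p h.
Proof. by rewrite /= => ->. Qed.

Definition flow_subgraph S G (phi : lmorph S G) (iv : injective (vmap phi))
  (ie : injective (emap phi)) : flow S G.
Proof.
apply: (@Flow S G (vmap phi) (fun g => [pick s | emap phi s == g])) => //.
- exact: vmap_root.
- exact: vmap_leaf.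
move=> a x.
have E (F : edge G -> nat) :
    \sum_g ([pick s | emap phi s == g] == Some a) * F g = F (emap phi a).
  rewrite -(sum_pick F); apply: eq_bigr => g _; congr (_ * _); congr nat_of_bool.
  case: pickP => [s /eqP <-|/(_ a)]; first by rewrite (inj_eq ie) (inj_eq (@Some_inj _)).
  by rewrite eq_sym => ->.
by rewrite !E -vmap_src -vmap_tgt addnC.
Defined.

Lemma flow_subgraphE S G (phi : lmorph S G) iv ie a :
  fc (@flow_subgraph S G phi iv ie) (emap phi a) = Some a.
Proof.
rewrite /=; case: pickP => [s /eqP /ie -> //|/(_ a)]; by rewrite eqxx.
Qed.

Definition giso_lmorph G H (p : giso G H) : lmorph G H :=
  LMorph (fun e => esym (gsrc p e)) (fun e => esym (gtgt p e)) (groot p) (gleaf p).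

Definition flow_giso G H (p : giso G H) : flow G H :=
  @flow_subgraph G H (giso_lmorph p) (@gv_inj _ _ _ p) (@ge_inj _ _ _ p).

Lemma flow_gisoE G H (p : giso G H) e : fc (flow_giso p) (ge p e) = Some e.
Proof. exact: (@flow_subgraphE G H (giso_lmorph p)). Qed.

Definition add_edge_lmorph G (u v : vert G) : lmorph G (add_edge u v) :=
  @LMorph n G (add_edge u v) id Some (fun=> erefl) (fun=> erefl) erefl
    (fun=> erefl).

Definition flow_add_edge G (u v : vert G) : flow G (add_edge u v) :=
  @flow_subgraph G (add_edge u v) (add_edge_lmorph u v) (@inj_id _)
    (@Some_inj _).

Definition merge_edge G (e : edge G) (f : edge (subdivide e)) : edge G :=
  if f is Some g then g else e.

Definition flow_subdivide G (e : edge G) : flow G (subdivide e).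
Proof.
apply: (@Flow G (subdivide e) Some (fun f => Some (merge_edge f))) => //.
  exact: (@Some_inj _).
move=> a x; rewrite !sum_option /= !(inj_eq (@Some_inj _)).
under eq_bigr => g _ do rewrite (inj_eq (@Some_inj _)).
under [in RHS]eq_bigr => g _ do rewrite (inj_eq (@Some_inj _)).
rewrite !(sum_pick (fun g => _)); case: (eqVneq e a) => [->|ne].
  by rewrite !mul1n; lia.
by rewrite !mul0n !add0n addnC.
Defined.

Definition flow_add_edge_restrict K G (u v : vert G)
  (p : flow K (add_edge u v)) (pN : fc p None = None) : flow K G.
Proof.
apply: (@Flow K G (fv p) (fun g => fc p (Some g))).
- exact: (@fv_inj _ _ p).
- exact: (fv_root p).
- exact: (fv_leaf p).
by move=> a x; have := fcons p a x; rewrite !sum_option pN.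
Defined.

Lemma flow_avoids_new K G (e : edge G) (p : flow K (subdivide e)) k :
  is_network K -> fv p k <> None.
Proof.
move=> nK fk.
have ac := network_acyclic nK.
have cons a : (fc p None == Some a) + (fv p (tgt a) == None) =
              (fc p (Some e) == Some a) + (fv p (src a) == None).
  have := fcons p a None; rewrite !sum_option /= muln0 muln1.
  rewrite [X in _ + X + _ = _]big1 => [|g _]; last by rewrite muln0.
  rewrite (bigD1 e) //= eqxx muln1 [X in _ = _ + (_ + X) + _]big1; last first.
    by move=> g /negPf ->; rewrite muln0.
  by rewrite !addn0 !add0n.
have Nk k' : (fv p k' == None) = (k' == k).
  by rewrite -fk (inj_eq (@fv_inj _ _ p)).
have nloop a := acyclic_loop a ac.
case: (vertex_kind k nK) => [[kr _]|/(network_leaf nK)[i ki]||].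
- by have := fv_root p; rewrite -kr fk.
- by have := fv_leaf p i; rewrite ki fk.
- move=> /andP[_ /eqP o2].
  have /outdeg_gt1P[a [b [ab sa sb]]] : 1 < outdeg k by rewrite o2.
  have h d : src d = k -> fc p None = Some d.
    move=> sd; have := cons d; rewrite !Nk sd eqxx -sd (eq_sym (tgt d)) (negPf (nloop d)).
    by case: eqP => //; case: eqP.
  by move: ab; rewrite -(inj_eq (@Some_inj _)) -(h a sa) -(h b sb) eqxx.
- move=> /andP[/eqP i2 _].
  have /indeg_gt1P[a [b [ab ta tb]]] : 1 < indeg k by rewrite i2.
  have h d : tgt d = k -> fc p (Some e) = Some d.
    move=> td; have := cons d; rewrite !Nk td eqxx -td (negPf (nloop d)).
    by case: eqP => // _; case: eqP.
  by move: ab; rewrite -(inj_eq (@Some_inj _)) -(h a ta) -(h b tb) eqxx.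
Qed.

Lemma flow_subdivide_restrict K G (e : edge G) :
  is_network K -> flow K (subdivide e) -> inhabited (flow K G).
Proof.
move=> nK p.
have av k := @flow_avoids_new _ _ _ p k nK.
pose h k := odflt (src e) (fv p k).
have hE k : fv p k = Some (h k) by rewrite /h; case: (fv p k) (av k).
have cE : fc p None = fc p (Some e).
  have E a : (fc p None == Some a) = (fc p (Some e) == Some a).
    have := fcons p a None; rewrite !sum_option /= muln0 muln1 !hE /=.
    rewrite [X in _ + X + _ = _]big1 => [|g _]; last by rewrite muln0.
    rewrite (bigD1 e) //= eqxx muln1 [X in _ = _ + (_ + X) + _]big1; last first.
      by move=> g /negPf ->; rewrite muln0.
    by rewrite !addn0 !add0n; do 2 case: eqP.
  case E1 : (fc p None) => [a|]; first by move: (E a); rewrite E1 eqxx => /esym/eqP.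
  case E2 : (fc p (Some e)) => [a|] //; move: (E a); by rewrite E1 E2 eqxx.
split; apply: (@Flow K G h (fun g => fc p (Some g))).
- by move=> k l kl; apply: (@fv_inj _ _ p); rewrite !hE kl.
- by apply: (@Some_inj _); rewrite -hE fv_root.
- by move=> i; apply: (@Some_inj _); rewrite -hE fv_leaf.
move=> a x; have := fcons p a (Some x).
rewrite !sum_option /= muln0 add0n !hE !(inj_eq (@Some_inj _)) => ->.
rewrite cE (bigD1 e) //= eqxx muln0 add0n [in RHS](bigD1 e) //=.
by congr (_ + _ + _); apply: eq_bigr => g /negPf ->.
Qed.

Lemma flow_add_reticulation_restrict K G (e : edge G) f
    (p : flow K (@add_reticulation n G e f)) :
  is_network K -> fc p None = None -> inhabited (flow K G).
Proof.
move=> nK pN; have q := flow_add_edge_restrict pN.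
have [r] := flow_subdivide_restrict nK q.
exact: flow_subdivide_restrict nK r.
Qed.

Definition flow_add_reticulation G (e : edge G) f :
    flow G (@add_reticulation n G e f) :=
  flow_comp (flow_subdivide e)
    (flow_comp (flow_subdivide f) (@flow_add_edge (subdivide f) None (Some None))).

Lemma flow_add_reticulationN G (e : edge G) f :
  fc (@flow_add_reticulation G e f) None = None.
Proof. by rewrite /flow_add_reticulation /=; case: pickP. Qed.

Lemma flow_add_reticulationS G (e : edge G) f (g : edge (subdivide f)) :
  fc (@flow_add_reticulation G e f) (Some g) = Some (merge_edge (merge_edge g)).
Proof.
rewrite /flow_add_reticulation /=; case: pickP => [s /eqP [->]//|/(_ g)].
by rewrite eqxx.
Qed.

Lemma flow_of_embedding K G : has_embedding K G -> inhabited (flow K G).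
Proof.
case=> S [sub [phi [iv ie]]].
suff [q] : inhabited (flow K S).
  by split; exact: flow_comp q (flow_subgraph iv ie).
elim: sub => [|H e _ [q]]; first by split; exact: flow_giso (giso_refl K).
by split; exact: flow_comp q (flow_subdivide e).
Qed.

Lemma colour_gt0 K G (p : flow K G) (t : edge G -> vert G) a x :
  (0 < \sum_g (fc p g == Some a) * (t g == x)) ->
  exists2 g, fc p g = Some a & t g = x.
Proof.
case: (pickP (fun g => (fc p g == Some a) && (t g == x))) => [g|no].
  by move=> /andP[/eqP ? /eqP ?] _; exists g.
rewrite big1 // => g _; have := no g; by do 2 case: eqP.
Qed.

Lemma colour_sum_gt0 K G (p : flow K G) (t : edge G -> vert G) g a :
  fc p g = Some a -> 0 < \sum_h (fc p h == Some a) * (t h == t g).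
Proof. by move=> c; rewrite (bigD1 g) //= c !eqxx. Qed.

Lemma colour_out K G (p : flow K G) a : acyclic K ->
  exists2 g, fc p g = Some a & src g = fv p (src a).
Proof.
move=> ac; apply: colour_gt0.
have := fcons p a (fv p (src a)); rewrite eqxx (inj_eq (@fv_inj _ _ p)).
by rewrite eq_sym (negPf (acyclic_loop a ac)); lia.
Qed.

Lemma colour_in K G (p : flow K G) a : acyclic K ->
  exists2 g, fc p g = Some a & tgt g = fv p (tgt a).
Proof.
move=> ac; apply: colour_gt0.
have := fcons p a (fv p (tgt a)); rewrite eqxx (inj_eq (@fv_inj _ _ p)).
by rewrite (negPf (acyclic_loop a ac)); lia.
Qed.

Section Split.

Variables (S G : lgraph n) (p : flow S G) (a : edge S) (g0 : edge G).
Hypotheses (cg0 : fc p g0 = Some a) (sg0 : src g0 = fv p (src a))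
  (new : forall k, fv p k <> tgt g0).

Let h (x : vert (subdivide a)) := if x is Some y then fv p y else tgt g0.
Let c (g : edge G) : option (edge (subdivide a)) :=
  if fc p g == Some a then (if g == g0 then Some (Some a) else Some None)
  else omap Some (fc p g).

Definition flow_split : flow (subdivide a) G.
Proof.
apply: (@Flow (subdivide a) G h c).
- move=> [x|] [y|] //=; first by move/(@fv_inj _ _ p) ->.
    by move/new.
  by move/esym/new.
- exact: (fv_root p).
- exact: (fv_leaf p).
have cE g b : b != a -> (c g == Some (Some b)) = (fc p g == Some b).
  move=> ne; rewrite /c; case: (eqVneq (fc p g) (Some a)) => [->|_].
    rewrite (inj_eq (@Some_inj _)) [in RHS]eq_sym (negPf ne).
    case: ifP => _ //; rewrite !(inj_eq (@Some_inj _)) eq_sym; exact: negPf.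
  by case: (fc p g).
have cA g : (c g == Some (Some a)) = (g == g0).
  rewrite /c; case: (eqVneq g g0) => [->|ne]; first by rewrite cg0 !eqxx.
  case: (eqVneq (fc p g) (Some a)) => // ne'.
  by case: (fc p g) ne' => // b; rewrite /= !(inj_eq (@Some_inj _)) => /negPf.
have cN g : (c g == Some None) + (g == g0) = (fc p g == Some a).
  rewrite /c; case: (eqVneq g g0) => [->|ne]; first by rewrite cg0 eqxx.
  by case: (eqVneq (fc p g) (Some a)) => // _; case: (fc p g).
move=> [b|] x /=.
  case: (eqVneq b a) => [->|ne] /=.
    under eq_bigr => g _ do rewrite cA.
    under [in RHS]eq_bigr => g _ do rewrite cA.
    by rewrite !(sum_pick (fun g => _)) sg0 addnC.
  under eq_bigr => g _ do rewrite cE //.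
  under [in RHS]eq_bigr => g _ do rewrite cE //.
  exact: fcons.
have E (t : edge G -> vert G) : \sum_g (c g == Some None) * (t g == x) +
    (t g0 == x) = \sum_g (fc p g == Some a) * (t g == x).
  rewrite -(sum_pick (fun g => nat_of_bool (t g == x)) g0) -big_split /=.
  by apply: eq_bigr => g _; rewrite -mulnDl cN.
have := fcons p a x; rewrite -(E (@src n G)) -(E (@tgt n G)) sg0.
by rewrite [LHS]addnAC => /addIn.
Defined.

End Split.

Definition interior_degrees S := forall k : vert S,
  [\/ k = root S, exists i, k = leaf S i | 0 < indeg k /\ 0 < outdeg k].

Lemma interior_degrees_subdivide S (e : edge S) :
  interior_degrees S -> interior_degrees (subdivide e).
Proof.
move=> d [k|]; last first.
  by apply: Or33; rewrite indeg_subdivide_new outdeg_subdivide_new.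
case: (d k) => [->|[i ->]|[h1 h2]]; first exact: Or31.
  by apply: Or32; exists i.
by apply: Or33; rewrite indeg_subdivide outdeg_subdivide.
Qed.

Lemma flow_new_vertex S G (p : flow S G) a g0 :
  acyclic S -> interior_degrees S -> is_network G ->
  fc p g0 = Some a -> src g0 = fv p (src a) -> tgt g0 <> fv p (tgt a) ->
  forall k, fv p k <> tgt g0.
Proof.
move=> ac d nG cg sg tg k fk.
have acG := network_acyclic nG.
have ska : k != src a.
  apply: contra (acyclic_loop g0 acG) => /eqP ka.
  by rewrite sg -ka fk.
have tka : k != tgt a by apply/eqP => ka; apply: tg; rewrite -fk ka.
have [g' cg' sg'] : exists2 g, fc p g = Some a & src g = fv p k.
  apply: colour_gt0; have := fcons p a (fv p k); rewrite !(inj_eq (@fv_inj _ _ p)).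
  rewrite !(eq_sym _ k) (negPf ska) (negPf tka) !addn0 => ->.
  by rewrite fk; exact: colour_sum_gt0 (@tgt n G) _ _ cg.
case: (d k) => [kr|[i ki]|[/indeg_gt0P[b tb] /outdeg_gt0P[b' sb]]].
- have /andP[/eqP i0 _] := network_root nG.
  by have := indeg_gt0 g0; rewrite -fk kr fv_root i0.
- have /(network_leaf nG)/andP[_ /eqP o0] : exists j, leaf G j = fv p k.
    by exists i; rewrite ki fv_leaf.
  by have := outdeg_gt0 g'; rewrite sg' o0.
have [h ch th] := colour_in p b ac.
have [h' ch' sh] := colour_out p b' ac.
have i2 : 1 < indeg (fv p k).
  apply/indeg_gt1P; exists h, g0; split; rewrite ?th ?tb //.
  apply: contra tka => /eqP e; rewrite -tb.
  by move: ch; rewrite e cg => -[->].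
have o2 : 1 < outdeg (fv p k).
  apply/outdeg_gt1P; exists h', g'; split; rewrite ?sh ?sb //.
  apply: contra ska => /eqP e; rewrite -sb.
  by move: ch'; rewrite e cg' => -[->].
case: (vertex_kind (fv p k) nG) => [[_]|||] /andP[/eqP h1 /eqP h2].
all: by move: i2 o2; rewrite h1 h2.
Qed.

Lemma embedding_of_interior_flow G S : is_network G ->
  acyclic S -> interior_degrees S -> flow S G -> has_embedding S G.
Proof.
move=> nG; have [m] := ubnP (#|edge G|.+1 - #|edge S|).
elim: m S => // m IH S mS ac d p.
have ex a : exists g, (fc p g == Some a) && (src g == fv p (src a)).
  by have [g h1 h2] := colour_out p a ac; exists g; rewrite h1 h2 !eqxx.
pose g a := xchoose (ex a).
have gc a : fc p (g a) = Some a by case/andP: (xchooseP (ex a)) => /eqP.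
have gs a : src (g a) = fv p (src a) by case/andP: (xchooseP (ex a)) => _ /eqP.
have gi : injective g by move=> a b ab; apply: (@Some_inj); rewrite -!gc ab.
have le := leq_card g gi.
case: (pickP (fun a => tgt (g a) != fv p (tgt a))) => [a /eqP ta|all].
  have new := flow_new_vertex ac d nG (gc a) (gs a) ta.
  have [|||S' [sub emb]] := IH (subdivide a) _ _ _ (flow_split (gc a) (gs a) new).
  - by rewrite card_option; move: mS le => /=; lia.
  - exact/acyclic_subdivide.
  - exact: interior_degrees_subdivide.
  exists S'; split=> //; elim: sub => [|H e _]; last exact: subdivision_step.
  exact/subdivision_step/subdivision_refl.
exists S; split; first exact: subdivision_refl.
have gt a : fv p (tgt a) = tgt (g a) by apply/esym/eqP/negbFE/all.
exists (LMorph (fun a => esym (gs a)) gt (fv_root p) (fv_leaf p)).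
by split=> //; exact: fv_inj.
Qed.

Lemma interior_degrees_network K : is_network K -> interior_degrees K.
Proof.
move=> nK k; case: (vertex_kind k nK) => [[->]|/(network_leaf nK)[i <-]||].
- by move=> _; exact: Or31.
- by apply: Or32; exists i.
- by case/andP=> /eqP h1 /eqP h2; apply: Or33; rewrite h1 h2.
- by case/andP=> /eqP h1 /eqP h2; apply: Or33; rewrite h1 h2.
Qed.

Lemma embedding_flow K G : is_network K -> is_network G ->
  has_embedding K G <-> inhabited (flow K G).
Proof.
move=> nK nG; split; first exact: flow_of_embedding.
case=> p; apply: embedding_of_interior_flow p => //.
  exact: network_acyclic.
exact: interior_degrees_network.
Qed.

Section ColouredEdges.

Variables (T N : network n) (p : flow T N).
Hypothesis treeT : is_tree T.

Let coloured g : nat := fc p g != None.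

Lemma coloured_in_out x : is_reticulation x ->
  \sum_g coloured g * (tgt g == x) <= \sum_g coloured g * (src g == x).
Proof.
move=> rx.
have E (F : edge N -> nat) : \sum_g coloured g * F g =
    \sum_a \sum_g (fc p g == Some a) * F g.
  have -> : \sum_g coloured g * F g =
      \sum_g (if fc p g is Some a then 1 else 0) * F g.
    by apply: eq_bigr => g _; rewrite /coloured; case: (fc p g).
  by rewrite (sum_colour _ _ (fun=> 1)); apply: eq_bigr => a _; rewrite mul1n.
rewrite !E.
suff le : \sum_a (fv p (tgt a) == x) <= \sum_a (fv p (src a) == x).
  rewrite -(leq_add2r (\sum_a (fv p (src a) == x))) -big_split /=.
  under eq_bigr => a _ do rewrite -fcons.
  by rewrite big_split leq_add2l.
case: (pickP (fun k => fv p k == x)) => [k /eqP kx|no]; last first.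
  by rewrite big1 // => a _; rewrite no.
rewrite -kx; under eq_bigr => a _ do rewrite (inj_eq (@fv_inj _ _ p)).
under [X in _ <= X]eq_bigr => a _ do rewrite (inj_eq (@fv_inj _ _ p)).
rewrite -indegE -outdegE.
case: (vertex_kind k (networkP T)) => [[kr _]|lk||rk].
- have /andP[/eqP i0 _] := network_root (networkP N).
  by move: rx; rewrite -kx kr fv_root /is_reticulation i0.
- have [i ki] := proj1 (network_leaf (networkP T) k) lk.
  have /(network_leaf (networkP N))/andP[_ /eqP o0] : exists j, leaf N j = x.
    by exists i; rewrite -kx -ki fv_leaf.
  by move: rx; rewrite /is_reticulation o0 andbF.
- by case/andP=> /eqP -> /eqP ->.
- by move: (treeT k); rewrite rk.
Qed.

Lemma uncoloured_in_edge (e e' : edge N) :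
  is_reticulation (tgt e) -> tgt e' = tgt e -> e != e' ->
  fc p e = None \/ fc p e' = None.
Proof.
move=> re te ne; have := coloured_in_out re.
have /andP[_ /eqP o1] := re.
case E1 : (fc p e) => [a|]; last by left.
case E2 : (fc p e') => [b|]; last by right.
rewrite (bigD1 e) //= (bigD1 e') 1?eq_sym //= /coloured E1 E2 te eqxx.
rewrite addnA => /(leq_trans (leq_addr _ _)) h.
have : \sum_g coloured g * (src g == tgt e) <= outdeg (tgt e).
  by rewrite outdegE; apply: leq_sum => g _; rewrite /coloured; case: (_ != _);
    case: (_ == _).
by rewrite o1 => /(leq_trans h).
Qed.

Lemma coloured_out_edge (e f : edge N) :
  is_reticulation (tgt e) -> src f = tgt e -> fc p f = None -> fc p e = None.
Proof.
move=> re sf fN; have := coloured_in_out re; have /andP[_ /eqP o1] := re.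
rewrite [X in _ <= X]big1 => [|g _]; last first.
  case: (eqVneq (src g) (tgt e)) => [sg|]; last by rewrite muln0.
  by rewrite (@outdeg1_inj _ _ f g) /coloured ?fN ?sf ?sg ?o1.
rewrite leqn0 sum_nat_eq0 => /forallP /(_ e) /=.
by rewrite /coloured eqxx muln1; case: (fc p e).
Qed.

End ColouredEdges.

Lemma subdivision_card K S :
  subdivision K S -> S = K \/ #|vert K| < #|vert S|.
Proof.
elim=> [|H e _ [E|lt]]; first by left.
  by right; rewrite card_option E.
by right; rewrite card_option; exact: ltnW.
Qed.

Lemma tree_flow_iso (T T' : network n) :
  is_tree T -> is_tree T' -> flow T T' -> isomorphic T T'.
Proof.
move=> /tree_reticulation_number rT /tree_reticulation_number rT' p.
have [S [sub [phi [iv ie]]]] : has_embedding T T'.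
  by apply/embedding_flow; [exact: networkP | exact: networkP | ].
have cv : #|vert T| = #|vert T'| by rewrite !card_vert rT rT'.
have ce : #|edge T| = #|edge T'|.
  by apply: succn_inj; rewrite !card_edge rT rT' cv.
case: (subdivision_card sub) => [E|]; last first.
  by rewrite ltnNge cv (leq_card _ iv).
move: phi iv ie; rewrite E => phi iv ie; exists phi.
by split; apply: inj_card_bij => //; rewrite ?cv ?ce.
Qed.

End Flows.

Section Operations.

Variable n : nat.
Implicit Types (G H K : lgraph n) (N T M : network n).

Lemma giso_of_iso G H (phi : lmorph G H) : is_iso phi ->
  exists p : giso G H, gv p = vmap phi.
Proof.
case=> -[gv' K1 K2] [ge' K3 K4].
by exists (@GIso n G H (vmap phi) (emap phi) gv' ge' K1 K2 K3 K4
  (fun e => esym (vmap_src phi e)) (fun e => esym (vmap_tgt phi e))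
  (vmap_root phi) (vmap_leaf phi)).
Qed.

Lemma giso_lmorph_iso G H (p : giso G H) : is_iso (giso_lmorph p).
Proof.
split; first by exists (gv' p); [exact: gvK | exact: gv'K].
by exists (ge' p); [exact: geK | exact: ge'K].
Qed.

Lemma giso_isomorphic G H : giso G H -> isomorphic G H.
Proof. by move=> p; apply/isomorphicP. Qed.

Lemma suppression_delete N (e : edge N) H (j : vert H -> vert N) v :
  suppression (G := delete_edge e) (src e) j -> j v = tgt e ->
  exists f : edge H, isomorphic (graft f v) N.
Proof.
case=> h [phi [/giso_of_iso[p pE] pN pS]] jv; exists h.
apply: giso_isomorphic; apply: giso_trans (giso_add_delete e).
have <- : gv p None = src e by rewrite pE.
have <- : gv p (Some v) = tgt e by rewrite pE pS.
exact: giso_add_edge p None (Some v).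
Qed.

Lemma delete_suppression N H (f : edge H) v (p : giso (graft f v) N) :
  suppression (G := delete_edge (ge p None)) (src (ge p None))
    (fun x => gv p (Some x)).
Proof.
exists f, (giso_lmorph (giso_delete_add p)); split.
- exact: giso_lmorph_iso.
- by rewrite gsrc.
- by [].
Qed.

Lemma graft_new_inner N H (f : edge H) v (p : giso (graft f v) N) :
  is_inner_tree_vertex (src (ge p None)).
Proof.
rewrite gsrc /is_inner_tree_vertex indeg_giso outdeg_giso.
by rewrite indeg_graft_new outdeg_graft_new.
Qed.

Lemma SNPR0P N N' : SNPR0 N N' <->
  exists H (f f' : edge H) v, [/\ isomorphic (graft f v) N,
    isomorphic (graft f' v) N' & ~~ connect (@adj n H) v (src f')].
Proof.
split.
  case=> e [_ _ [H [j [v [f' [sup jv nd iso]]]]]].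
  have [f fN] := suppression_delete sup jv.
  by exists H, f, f', v; split.
case=> H [f [f' [v [/isomorphicP[p] iso nd]]]].
exists (ge p None); split.
- by rewrite /is_tree_vertex graft_new_inner.
- by rewrite gsrc -(groot p) => /gv_inj.
exists H, (fun x => gv p (Some x)), v, f'; split=> //.
  exact: delete_suppression.
by rewrite gtgt.
Qed.

Lemma SNPRplusP N N' : SNPRplus N N' <->
  exists (e : edge N) (f : edge (subdivide e)),
    isomorphic (add_reticulation f) N'.
Proof.
split=> [[e [f [_ iso]]]|[e [f /isomorphicP[p]]]]; exists e, f => //.
have nA := is_network_giso (giso_sym p) (networkP N').
have [_ nd] := proj1 (is_network_add_reticulation f) nA.
by split=> //; exact: giso_isomorphic.
Qed.

Lemma SNPRminusP N N' : SNPRminus N N' <-> SNPRplus N' N.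
Proof.
rewrite SNPRplusP; split.
  case=> e [_ _ [H [j [v [H' [j' [sup jv sup' /isomorphicP[r]]]]]]]].
  have [f fN] := suppression_delete sup jv.
  case: sup' => d [phi [/giso_of_iso[q qE] qN qS]].
  pose w := giso_trans (giso_sym q) (giso_subdivide r d).
  have wv : gv w v = None by rewrite /w /= -qN -qE gvK.
  exists (ge r d), (ge w f); apply: isomorphic_trans fN.
  apply: isomorphic_sym; apply: giso_isomorphic.
  by have := giso_graft w f v; rewrite wv.
case=> e [f /isomorphicP[p]]; exists (ge p None); split.
- by rewrite /is_tree_vertex graft_new_inner.
- have := retic_add_reticulation f.
  by rewrite gtgt /is_reticulation indeg_giso outdeg_giso.
exists (subdivide e), (fun x => gv p (Some x)), None, N', some; split.
- exact: delete_suppression.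
- by rewrite gtgt.
- exists e, (giso_lmorph (giso_refl (subdivide e))); split=> //.
  exact: giso_lmorph_iso.
- exact: isomorphic_refl.
Qed.

Lemma SNPR0_iso N N1 M M1 : isomorphic N N1 -> isomorphic M M1 ->
  SNPR0 N M -> SNPR0 N1 M1.
Proof.
move=> i j /SNPR0P[H [f [f' [v [h1 h2 h3]]]]]; apply/SNPR0P; exists H, f, f', v.
by split=> //; [exact: isomorphic_trans h1 i | exact: isomorphic_trans h2 j].
Qed.

Lemma SNPRplus_iso N N1 M M1 : isomorphic N N1 -> isomorphic M M1 ->
  SNPRplus N M -> SNPRplus N1 M1.
Proof.
move=> /isomorphicP[p] j /SNPRplusP[e [f h]]; apply/SNPRplusP.
exists (ge p e), (ge (giso_subdivide p e) f).
apply: isomorphic_trans j; apply: isomorphic_trans h; apply: isomorphic_sym.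
exact/giso_isomorphic/giso_add_reticulation.
Qed.

Lemma SNPR_iso N N1 M M1 : isomorphic N N1 -> isomorphic M M1 ->
  SNPR N M -> SNPR N1 M1.
Proof.
move=> i j [h|h|/SNPRminusP h]; first by apply: Or31; exact: SNPR0_iso h.
  by apply: Or32; exact: SNPRplus_iso h.
by apply: Or33; apply/SNPRminusP; exact: SNPRplus_iso h.
Qed.

Lemma SNPR_sequence_iso k N N1 M :
  isomorphic N N1 -> SNPR_sequence k N M -> SNPR_sequence k N1 M.
Proof.
move=> i s; case: s i => [A B j i|m A B C h s i].
  apply: SNPR_sequence0; apply: isomorphic_trans j; exact: isomorphic_sym.
apply: SNPR_sequenceS s; apply: SNPR_iso h => //; exact: isomorphic_refl.
Qed.

Lemma SNPR_sequence_cat k l N M P :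
  SNPR_sequence k N M -> SNPR_sequence l M P -> SNPR_sequence (k + l) N P.
Proof.
elim=> [A B i s|m A B C h _ IH s].
  exact: SNPR_sequence_iso (isomorphic_sym i) s.
by rewrite addSn; apply: SNPR_sequenceS h _; exact: IH.
Qed.

Lemma SNPR_sequence1 N M : SNPR N M -> SNPR_sequence 1 N M.
Proof.
move=> h; apply: SNPR_sequenceS h _; exact/SNPR_sequence0/isomorphic_refl.
Qed.

Definition ancestors G (x : vert G) := #|[set z | connect (@adj n G) z x]|.

Lemma ancestors_lt G (e : edge G) :
  acyclic G -> ancestors (src e) < ancestors (tgt e).
Proof.
move=> a; apply: proper_card; apply/properP; split.
  apply/subsetP => z; rewrite !inE => c.
  exact: connect_trans c (connect_edge e).
by exists (tgt e); rewrite inE ?connect0 // a.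
Qed.

Lemma root_child_connect G (e : edge G) : is_network G -> src e = root G ->
  forall y, y = root G \/ connect (@adj n G) (tgt e) y.
Proof.
move=> nG se y; have [m] := ubnP (ancestors y).
have /andP[_ /eqP or] := network_root nG.
elim: m y => // m IH y ly; case: (eqVneq y (root G)) => [|ny]; first by left.
right; have /indeg_gt0P[f tf] : 0 < indeg y.
  case: (vertex_kind y nG) => [[yr]|||]; first by rewrite yr eqxx in ny.
  1-3: by move=> /andP[/eqP ->].
have [|sf|c] := IH (src f).
- by have := ancestors_lt f (network_acyclic nG); rewrite tf; lia.
- by rewrite -tf (@outdeg1_inj _ _ e f) ?se ?or.
- by rewrite -tf; exact: connect_trans c (connect_edge f).
Qed.

Lemma root_child_not_retic G (e : edge G) :
  is_network G -> src e = root G -> ~~ is_reticulation (tgt e).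
Proof.
move=> nG se; apply/negP => /andP[/eqP i2 _].
have /andP[_ /eqP or] := network_root nG.
have /indeg_gt1P[a [b [ab ta tb]]] : 1 < indeg (tgt e) by rewrite i2.
wlog ae : a b ab ta tb / a != e.
  case: (eqVneq a e) => [ae|ne]; last by move/(_ a b); apply.
  by move/(_ b a); apply=> //; rewrite -?ae eq_sym.
case: (root_child_connect nG se (src a)) => [sa|].
  by move: ae; rewrite (@outdeg1_inj _ _ e a) ?se ?or // eqxx.
by rewrite -ta; apply/negP/network_acyclic.
Qed.

Lemma retic_parent_inner G (e : edge G) : is_network G ->
  is_reticulation (tgt e) -> ~~ is_reticulation (src e) ->
  is_inner_tree_vertex (src e).
Proof.
move=> nG rt /negPf rs.
case: (vertex_kind (src e) nG) => [[sr _]|/andP[_ /eqP o0]|//|].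
- by move: (root_child_not_retic nG sr); rewrite rt.
- by have := outdeg_gt0 e; rewrite o0.
- by rewrite rs.
Qed.

Lemma highest_vertex G (P : pred (vert G)) x : acyclic G -> P x ->
  exists2 w, P w & forall e : edge G, tgt e = w -> ~~ P (src e).
Proof.
move=> a Px; case: (arg_minnP (@ancestors G) Px) => w Pw mw; exists w => // e te.
apply/negP => /mw; rewrite leqNgt -te; move/negP; apply; exact: ancestors_lt.
Qed.

Lemma exists_displayed N : exists2 T, is_tree T & inhabited (flow T N).
Proof.
have [m] := ubnP (reticulation_number N); elim: m N => // m IH N lN.
case: (pickP (fun v : vert N => is_reticulation v)) => [v rv|no]; last first.
  exists N; first by move=> v; rewrite no.
  by split; exact/flow_giso/giso_refl.
have [w rw hw] := highest_vertex (network_acyclic (networkP N)) rv.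
have /indeg_gt0P[e te] : 0 < indeg w by case/andP: rw => /eqP ->.
have [|N' [d [f [p _]]]] :=
  add_reticulation_decomposition (networkP N) (e := e) _ (etrans (congr1 _ te) rw).
  apply: retic_parent_inner (hw _ te); first exact: networkP.
  by rewrite te.
have [|T tT [q]] := IH N'.
  by rewrite (reticulation_number_add p) in lN.
exists T => //; split; apply: flow_comp q (flow_comp _ (flow_giso p)).
exact: flow_add_reticulation.
Qed.

Lemma remove_edge T N (p : flow T N) (e : edge N) :
  is_inner_tree_vertex (src e) -> is_reticulation (tgt e) -> fc p e = None ->
  exists (N' : network n) (d : edge N') f (q : giso (@add_reticulation n N' d f) N),
    ge q None = e /\ inhabited (flow T N').
Proof.
move=> si rt pe.
have [N' [d [f [q qe]]]] := add_reticulation_decomposition (networkP N) si rt.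
exists N', d, f, q; split=> //.
apply: (@flow_add_reticulation_restrict _ _ _ _ _
  (flow_comp p (flow_giso (giso_sym q)))); first exact: networkP.
have -> : None = ge (giso_sym q) e by rewrite /= -qe geK.
by rewrite (flow_compE _ (flow_gisoE _ _)).
Qed.

End Operations.

Section Swap.

Variables (n : nat) (H : lgraph n) (v : vert H).

(* The graph in which [v] has a new parent with the two parents [Some (Some   *)
(* None)], subdividing [f], and [None], subdividing [g].                      *)
Definition double_graft (f : edge H)
    (g : edge (@subdivide n (graft f v) None)) : lgraph n :=
  @add_reticulation n (graft f v) None g.

Definition swap_vert (x : option (option (option (vert H)))) :=
  match x with
  | None => Some (Some None)
  | Some (Some None) => None
  | _ => x
  end.

Definition swap_edge (x : option (option (option (option (option (edge H)))))) :=
  match x with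
  | None => Some (Some (Some None))
  | Some (Some (Some None)) => None
  | Some None => Some (Some (Some (Some None)))
  | Some (Some (Some (Some None))) => Some None
  | _ => x
  end.

Lemma swap_vertK : involutive swap_vert.
Proof. by case=> [[[]|]|]. Qed.

Lemma swap_edgeK : involutive swap_edge.
Proof. by case=> [[[[[]|]|]|]|]. Qed.

Definition giso_swap f k : f != k ->
  giso (@double_graft f (Some (Some (Some k))))
       (@double_graft k (Some (Some (Some f)))).
Proof.
move=> fk.
apply: (@GIso n (@double_graft f (Some (Some (Some k))))
          (@double_graft k (Some (Some (Some f)))) swap_vert swap_edge
          swap_vert swap_edge) => //.
- exact: swap_vertK.
- exact: swap_vertK.
- exact: swap_edgeK.
- exact: swap_edgeK.
- by case=> [[[[[]|]|]|]|].
case=> [[[[[g|]|]|]|]|] //=; last first.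
- by rewrite eq_sym (negPf fk).
- by rewrite (negPf fk).
have SE (x y : edge H) : (Some (Some (Some x)) == Some (Some (Some y))) = (x == y).
  by [].
rewrite !SE; case: (eqVneq g k) => [->|gk]; first by rewrite eq_sym (negPf fk).
by case: (eqVneq g f).
Defined.

Definition giso_swap_same f :
  giso (@double_graft f (Some (Some (Some f))))
       (@double_graft f (Some (Some None))).
Proof.
apply: (@GIso n (@double_graft f (Some (Some (Some f))))
          (@double_graft f (Some (Some None))) swap_vert swap_edge
          swap_vert swap_edge) => //.
- exact: swap_vertK.
- exact: swap_vertK.
- exact: swap_edgeK.
- exact: swap_edgeK.
- by case=> [[[[[]|]|]|]|].
case=> [[[[[g|]|]|]|]|] //=; rewrite ?eqxx //.
have SE (x y : edge H) : (Some (Some (Some x)) == Some (Some (Some y))) = (x == y).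
  by [].
by rewrite SE; case: (eqVneq g f).
Defined.

Lemma exists_swap f (g : edge (@subdivide n (graft f v) None)) :
  g <> None -> g <> Some None ->
  exists f' g' (s : giso (double_graft g) (@double_graft f' g')),
    ge s (Some (Some (Some None))) = None.
Proof.
case: g => [[[k|]|]|] // _ _.
  case: (eqVneq f k) => [<-|fk].
    by exists f, (Some (Some None)), (giso_swap_same f).
  by exists k, (Some (Some (Some f))), (giso_swap fk).
by exists f, (Some (Some (Some f))), (giso_sym (giso_swap_same f)).
Qed.

End Swap.

Section Redirect.

Variable n : nat.
Implicit Types (G H K : lgraph n) (N T M : network n).

Lemma merge_edge_tgt G (e : edge G) (f : edge (subdivide e)) y :
  tgt f = Some y -> tgt (merge_edge f) = y.
Proof. by case: f => [f|] /= => [|[]//]; case: eqP => // _ []. Qed.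

Lemma merge_edge_inj G (e : edge G) (f f' : edge (subdivide e)) y y' :
  tgt f = Some y -> tgt f' = Some y' -> merge_edge f = merge_edge f' -> f = f'.
Proof.
case: f f' => [f|] [f'|] //= t t'; first by move=> ->.
  by move=> E; move: t; rewrite E eqxx.
by move=> E; move: t'; rewrite -E eqxx.
Qed.

Lemma giso_parallelP G (e f : edge G) : src e = src f -> tgt e = tgt f ->
  exists p : giso G G, ge p f = e.
Proof.
move=> st tt.
pose s g := if g == e then f else if g == f then e else g.
have sK : involutive s.
  move=> g; rewrite /s; case: (eqVneq g e) => [->|ge]; last first.
    case: (eqVneq g f) => [->|gf]; first by rewrite eqxx.
    by rewrite (negPf ge) (negPf gf).
  by rewrite eqxx; case: eqP.
have ss g : src (s g) = src g.
  by rewrite /s; case: eqP => [->//|_]; case: eqP => [->|].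
have ts g : tgt (s g) = tgt g.
  by rewrite /s; case: eqP => [->//|_]; case: eqP => [->|].
exists (@GIso n G G id s id s (fun=> erefl) (fun=> erefl) sK sK ss ts erefl
  (fun=> erefl)).
by rewrite /= /s eqxx; case: eqP.
Qed.

Lemma reticulation_number_vert N M :
  #|vert N| = #|vert M| -> reticulation_number N = reticulation_number M.
Proof. rewrite !card_vert; lia. Qed.

Lemma card_vert_giso G H : giso G H -> #|vert G| = #|vert H|.
Proof. by move=> p; exact: bij_eq_card (Bijective (gvK p) (gv'K p)). Qed.

Lemma redirect T N (p : flow T N) (e e1 : edge N) :
  is_tree T -> is_reticulation (tgt e) -> tgt e1 = tgt e -> e != e1 ->
  exists T', [/\ is_tree T', exists q : flow T' N, fc q e = None &
    isomorphic T T' \/ SNPR0 T T'].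
Proof.
have [m] := ubnP (reticulation_number N).
elim: m N p e e1 => // m IH N p e e1 lN tT re te ne.
have nN := networkP N.
have same (q : flow T N) : fc q e = None -> exists T', [/\ is_tree T',
    exists q : flow T' N, fc q e = None & isomorphic T T' \/ SNPR0 T T'].
  by move=> qe; exists T; split=> //; [exists q | left; exact: isomorphic_refl].
case Ce : (fc p e) => [a|]; last exact: same p Ce.
have e1N : fc p e1 = None.
  by case: (uncoloured_in_edge p tT re te ne) => //; rewrite Ce.
case: (eqVneq (src e) (src e1)) => [par|npar].
  have [s se] := giso_parallelP par (esym te).
  by apply: (same (flow_comp p (flow_giso s))); rewrite -se (flow_compE _ (flow_gisoE _ _)).
pose other w := is_reticulation w && (w != tgt e).
case: (pickP other) => [w0 Pw0|only].
  have [w /andP[rw wv] hw] := highest_vertex (P := other) (network_acyclic nN) Pw0.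
  have [ew tw cw] : exists2 g, tgt g = w & fc p g = None.
    have /indeg_gt1P[b [c [bc tb tc]]] : 1 < indeg w.
      by case/andP: rw => /eqP ->.
    have rb : is_reticulation (tgt b) by rewrite tb.
    case: (uncoloured_in_edge p tT rb _ bc); first by rewrite tb tc.
      by exists b.
    by exists c.
  have sv : src ew != tgt e.
    apply/eqP => sv; move: (coloured_out_edge tT re sv cw).
    by rewrite Ce.
  have sw : is_inner_tree_vertex (src ew).
    apply: retic_parent_inner => //; first by rewrite tw.
    by have := hw _ tw; rewrite /other sv andbT.
  have rt : is_reticulation (tgt ew) by rewrite tw.
  have [N' [d [f [q [qe [p']]]]]] := remove_edge (p := p) sw rt cw.
  case Ev : (gv' q (tgt e)) => [[v0|]|]; last first.
  - by move: sv; rewrite -qe gsrc /= -Ev gv'K eqxx.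
  - by move: wv; rewrite -tw -qe gtgt /= -Ev gv'K eqxx.
  have qv : gv q (Some (Some v0)) = tgt e by rewrite -Ev gv'K.
  have lift g : tgt g = tgt e ->
      exists2 h : edge (subdivide f), g = ge q (Some h) & tgt h = Some (Some v0).
    move=> tg; case Eg : (ge' q g) => [h|]; last first.
      by move: wv; rewrite -tg -tw -qe -Eg ge'K eqxx.
    have gh : g = ge q (Some h) by rewrite -Eg ge'K.
    exists h => //; apply: (@gv_inj _ _ _ q); rewrite qv -tg gh gtgt //.
  have [h eh th] := lift e erefl.
  have [h1 eh1 th1] := lift e1 te.
  have rv0 : is_reticulation v0.
    move: re; rewrite /is_reticulation -qv indeg_giso outdeg_giso.
    by rewrite indeg_add_reticulation outdeg_add_reticulation.
  have t0 : tgt (merge_edge (merge_edge h)) = v0.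
    exact/merge_edge_tgt/merge_edge_tgt.
  have t1 : tgt (merge_edge (merge_edge h1)) = v0.
    exact/merge_edge_tgt/merge_edge_tgt.
  have ne0 : merge_edge (merge_edge h) != merge_edge (merge_edge h1).
    apply: contra ne => /eqP.
    move/(merge_edge_inj (merge_edge_tgt th) (merge_edge_tgt th1)).
    by move/(merge_edge_inj th th1); rewrite eh eh1 => ->.
  have [|||T' [tT' [q' qN] rel]] := IH N' p' _ _ _ tT _ _ ne0.
  - by rewrite (reticulation_number_add q) in lN.
  - by rewrite t0.
  - by rewrite t0 t1.
  exists T'; split=> //.
  exists (flow_comp q' (flow_comp (flow_add_reticulation f) (flow_giso q))).
  rewrite -qN; apply: flow_compE; rewrite eh (flow_compE _ (flow_gisoE _ _)).
  exact: flow_add_reticulationS.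
have nretic g : tgt g = tgt e -> is_inner_tree_vertex (src g).
  move=> tg; apply: retic_parent_inner => //; first by rewrite tg.
  apply/negP => rg; have := only (src g); rewrite /other rg -tg /=.
  by rewrite (acyclic_loop g (network_acyclic nN)).
have re1 : is_reticulation (tgt e1) by rewrite te.
have [T0 [d [g [q [qe [p0]]]]]] := remove_edge (p := p) (nretic _ te) re1 e1N.
have qv : gv q (Some None) = tgt e by rewrite -te -qe gtgt.
have tT0 : is_tree T0.
  move=> x; apply/negP => rx; have := only (gv q (Some (Some x))).
  rewrite /other -qv (inj_eq (@gv_inj _ _ _ q)) andbT /is_reticulation.
  rewrite indeg_giso outdeg_giso indeg_add_reticulation outdeg_add_reticulation.
  by rewrite -/(is_reticulation x) rx.
have isoT := tree_flow_iso tT tT0 p0.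
have [eE gd] : e = ge q (Some (Some (Some d))) /\ g <> Some d.
  case Eh : (ge' q e) => [h|]; last first.
    by move: ne; rewrite -qe -Eh ge'K eqxx.
  have eh : e = ge q (Some h) by rewrite -Eh ge'K.
  have th : tgt h = Some None by apply: (@gv_inj _ _ _ q); rewrite qv eh gtgt.
  have sh : src h <> None.
    move=> sh; move/eqP: npar; apply; rewrite eh -qe !gsrc; congr (gv q _).
    exact: sh.
  case: h eh th sh {Eh} => [h|] // -> /=.
  case: eqP => // hg; case: h hg => [h|] //= hg.
  by case: eqP hg => [->|//] hg _ _; split=> // E; apply: hg; rewrite E.
have sd : is_inner_tree_vertex (src d).
  have := nretic e erefl; rewrite eE gsrc /is_inner_tree_vertex indeg_giso.
  by rewrite outdeg_giso indeg_add_reticulation outdeg_add_reticulation.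
have [H [f [c [r rN]]]] := graft_decomposition (networkP T0) sd.
subst d.
pose g' := ge' (giso_subdivide r None) g.
have gE : ge (giso_subdivide r None) g' = g by rewrite ge'K.
move: g' gE => g' gE; subst g.
pose t := giso_trans (giso_add_reticulation r g') q.
have eE' : e = ge t (Some (Some (Some None))) by [].
have nQ := is_network_giso (giso_sym t) nN.
have [_ nd] := proj1 (is_network_add_reticulation g') nQ.
have [||f' [g'' [s sN]]] := @exists_swap n H c f g'.
- by move=> E; move: nd; rewrite E /edge_descendant connect0.
- by move=> E; apply: gd; rewrite E.
have nQ' := is_network_giso s nQ.
have [nT' _] := proj1 (is_network_add_reticulation g'') nQ'.
pose T' := Network nT'.
exists T'; split.
- apply/tree_reticulation_number.
  rewrite -(proj1 (tree_reticulation_number T0) tT0).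
  by apply: reticulation_number_vert; rewrite -(card_vert_giso r).
- exists (flow_comp (flow_add_reticulation g'')
            (flow_comp (flow_giso (giso_sym s)) (flow_giso t))).
  rewrite -(flow_add_reticulationN g''); apply: flow_compE.
  rewrite eE' (flow_compE _ (flow_gisoE _ _)).
  have -> : Some (Some (Some None)) = ge (giso_sym s) None.
    by rewrite /= -sN geK.
  exact: flow_gisoE.
- right; apply/SNPR0P; exists H, f, f', c; split.
  + apply: isomorphic_trans (isomorphic_sym isoT); exact: giso_isomorphic r.
  + exact: isomorphic_refl.
  + by have /network_acyclic/acyclic_graft[] := nT'.
Qed.

End Redirect.

Section TreeSpace.

Variable n : nat.
Implicit Types (G H K : lgraph n) (N T M : network n).

Lemma tree_indeg N (v : vert N) : is_tree N -> indeg v <= 1.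
Proof.
move=> tN; case: (vertex_kind v (networkP N)) => [[_]|||rv].
1-3: by move=> /andP[/eqP ->].
by move: (tN v); rewrite rv.
Qed.

Lemma network_outdeg G (v : vert G) : is_network G -> outdeg v <= 2.
Proof. by move=> nG; case: (vertex_kind v nG) => [[_]|||] /andP[_ /eqP ->]. Qed.

Lemma network_indeg_gt0 G (v : vert G) :
  is_network G -> v <> root G -> 0 < indeg v.
Proof.
by move=> nG nv; case: (vertex_kind v nG) => [[]//|||] /andP[/eqP ->].
Qed.

Lemma connect_last G (x y : vert G) : connect (@adj n G) x y -> x <> y ->
  exists2 e : edge G, tgt e = y & connect (@adj n G) x (src e).
Proof.
move: x; apply: connect_ind_l => // x z /adjP[e <- <-] c IH ne.
case: (eqVneq (tgt e) y) => [ty|/eqP ty]; first by exists e; rewrite ?connect0.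
by have [f tf cf] := IH ty; exists f => //; exact: connect_trans (connect_edge e) cf.
Qed.

Variable T' : network n.
Hypothesis treeT' : is_tree T'.

(* An isomorphism from a disjoint union of pendant subtrees of [T'], with     *)
(* vertex set [S], onto pendant subtrees of [G].                              *)
Record agreement G (S : {set vert T'}) (phi : vert T' -> vert G)
    (psi : edge T' -> edge G) : Prop := Agreement {
  agr_root : root T' \notin S;
  agr_leaf : forall i, leaf T' i \in S /\ phi (leaf T' i) = leaf G i;
  agr_edge : forall e, src e \in S ->
    [/\ tgt e \in S, src (psi e) = phi (src e) & tgt (psi e) = phi (tgt e)];
  agr_inj : {in S &, injective phi}
}.

Lemma agreement_giso G H (p : giso G H) S phi psi :
  @agreement G S phi psi -> agreement S (gv p \o phi) (ge p \o psi).
Proof.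
case=> r l e i; split=> //.
- by move=> j; have [h1 h2] := l j; rewrite /= h2 gleaf.
- by move=> f /e[h1 h2 h3]; split; rewrite //= ?gsrc ?gtgt ?h2 ?h3.
- by move=> x y xS yS /gv_inj; exact: i.
Qed.

Section Agreement.

Variables (G : lgraph n) (S : {set vert T'}).
Variables (phi : vert T' -> vert G) (psi : edge T' -> edge G).
Hypotheses (nG : is_network G) (agr : agreement S phi psi).

Lemma edge_inj_tgt (e f : edge T') : tgt e = tgt f -> e = f.
Proof. by apply: indeg1_inj; exact: tree_indeg. Qed.

Lemma agreement_psi_inj (e f : edge T') :
  src e \in S -> src f \in S -> psi e = psi f -> e = f.
Proof.
move=> /(agr_edge agr)[h1 _ h2] /(agr_edge agr)[h3 _ h4] E.
by apply: edge_inj_tgt; apply: (agr_inj agr) => //; rewrite -h2 -h4 E.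
Qed.

Lemma agreement_kind k : k \in S -> (exists i, k = leaf T' i) \/
  exists e f : edge T', [/\ e != f, src e = k & src f = k].
Proof.
move=> kS; case: (vertex_kind k (networkP T')) => [[kr _]|lk||rk].
- by move: kS; rewrite kr (negPf (agr_root agr)).
- by left; have [i <-] := proj1 (network_leaf (networkP T') k) lk; exists i.
- by move=> /andP[_ /eqP o2]; right; apply/outdeg_gt1P; rewrite o2.
- by move: (treeT' k); rewrite rk.
Qed.

Lemma agreement_not_root k : k \in S -> phi k <> root G.
Proof.
move=> kS kr; have /andP[/eqP i0 /eqP o1] := network_root nG.
case: (agreement_kind kS) => [[i ki]|[e [f [ef se sf]]]].
  have /(network_leaf nG)/andP[/eqP] : exists j, leaf G j = phi k.
    by exists i; rewrite ki; have [_ ->] := agr_leaf agr i.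
  by rewrite kr i0.
have [|_ s1 _] := agr_edge agr (e := e); first by rewrite se.
have [|_ s2 _] := agr_edge agr (e := f); first by rewrite sf.
move/eqP: ef; apply; apply: agreement_psi_inj; rewrite ?se ?sf //.
by apply: outdeg1_inj; rewrite ?s1 ?s2 ?sf ?se ?kr ?o1.
Qed.

Lemma agreement_out k g : k \in S -> src g = phi k ->
  exists2 e, src e = k & psi e = g.
Proof.
move=> kS sg; case: (agreement_kind kS) => [[i ki]|[e [f [ef se sf]]]].
  have /(network_leaf nG)/andP[_ /eqP o0] : exists j, leaf G j = phi k.
    by exists i; rewrite ki; have [_ ->] := agr_leaf agr i.
  by have := outdeg_gt0 g; rewrite sg o0.
have [|_ s1 _] := agr_edge agr (e := e); first by rewrite se.
have [|_ s2 _] := agr_edge agr (e := f); first by rewrite sf.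
case: (eqVneq (psi e) g) => [|ne]; first by exists e.
case: (eqVneq (psi f) g) => [|nf]; first by exists f.
have nef : psi e != psi f.
  by apply: contra ef => /eqP h; apply/eqP/agreement_psi_inj; rewrite ?se ?sf.
have : 2 < outdeg (phi k).
  apply/card_gt2P; exists (psi e), (psi f), g; rewrite !inE s1 s2 se sf sg eqxx.
  by split=> //; split=> //; rewrite eq_sym.
by rewrite ltnNge network_outdeg.
Qed.

Lemma agreement_connect k z : k \in S -> connect (@adj n G) (phi k) z ->
  exists k', [/\ k' \in S, phi k' = z & connect (@adj n T') k k'].
Proof.
move=> kS c.
suff P x : connect (@adj n G) x z -> forall k, k \in S -> phi k = x ->
    exists k', [/\ k' \in S, phi k' = z & connect (@adj n T') k k'].
  exact: P c k kS erefl.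
move: x {k kS c}; apply: connect_ind_l => [k kS kz|x y /adjP[g sg tg] _ IH k kS kx].
  by exists k; split.
have [e se eg] := agreement_out kS (etrans sg (esym kx)).
have [|tS _ te] := agr_edge agr (e := e); first by rewrite se.
have [|k' [k'S k'z ck]] := IH _ tS; first by rewrite -te eg tg.
by exists k'; split=> //; rewrite -se; exact: connect_trans (connect_edge e) ck.
Qed.

Lemma agreement_siblings (e f : edge T') : src e = src f -> e != f ->
  tgt e \in S -> tgt f \in S ->
  ~~ connect (@adj n G) (phi (tgt e)) (phi (tgt f)).
Proof.
move=> sef ef eS fS; apply/negP => /(agreement_connect eS)[k [kS kf c]].
rewrite (agr_inj agr kS fS kf) in c.
have [|g tg cg] := connect_last c.
  by move/edge_inj_tgt => E; rewrite E eqxx in ef.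
move: cg; rewrite (edge_inj_tgt tg) -sef.
by apply/negP/network_acyclic/networkP.
Qed.

End Agreement.

Lemma agreement_complete T S phi psi : is_tree T -> @agreement T S phi psi ->
  (forall k, k != root T' -> k \in S) -> isomorphic T T'.
Proof.
move=> tT agr full.
have nT := networkP T; have nT' := networkP T'.
have /andP[_ /eqP o1'] := network_root nT'.
have /andP[_ /eqP o1] := network_root nT.
have /outdeg_gt0P[e0' s0'] : 0 < outdeg (root T') by rewrite o1'.
have /outdeg_gt0P[e0 s0] : 0 < outdeg (root T) by rewrite o1.
have notin k : (k \in S) = (k != root T').
  apply/idP/idP => [kS|/full //]; apply: contraL kS => /eqP ->; exact: agr_root agr.
have only0 e : src e = root T' -> e = e0'.
  by rewrite -s0'; apply: outdeg1_inj; rewrite s0' o1'.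
pose h k := if k == root T' then root T else phi k.
pose he e := if e == e0' then e0 else psi e.
have hi : injective h.
  move=> x y; rewrite /h; case: (eqVneq x) => [->|/full xS].
    case: (eqVneq y) => // /full yS /esym.
    by move/(agreement_not_root nT agr yS).
  case: (eqVneq y) => [_ /(agreement_not_root nT agr xS) //|/full yS].
  exact: (agr_inj agr).
have cv : #|vert T'| = #|vert T|.
  rewrite !card_vert (proj1 (tree_reticulation_number T) tT).
  by rewrite (proj1 (tree_reticulation_number T') treeT').
have ce : #|edge T'| = #|edge T|.
  apply: succn_inj; rewrite !card_edge cv (proj1 (tree_reticulation_number T) tT).
  by rewrite (proj1 (tree_reticulation_number T') treeT').
have [h' hK h'K] : bijective h by apply: inj_card_bij => //; rewrite cv.
have c0 : tgt e0' != root T'.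
  apply/eqP => E; have := indeg_gt0 e0'; rewrite E.
  by have /andP[/eqP -> _] := network_root nT'.
have nE e : e != e0' -> src e \in S.
  by move=> ne; rewrite notin; apply: contra ne => /eqP/only0 ->.
have hc : tgt e0 = phi (tgt e0').
  have /indeg_gt0P[g tg] : 0 < indeg (phi (tgt e0')).
    apply: network_indeg_gt0 => //; apply: (agreement_not_root nT agr); exact: full.
  rewrite -tg; congr (tgt _); case: (eqVneq (h' (src g)) (root T')) => [E|/full E].
    have sg : src g = root T by rewrite -(h'K (src g)) E /h eqxx.
    by apply/esym; move: sg; rewrite -s0; apply: outdeg1_inj; rewrite s0 o1.
  have sg : src g = phi (h' (src g)).
    by rewrite -{1}(h'K (src g)) {1}/h; move: E; rewrite notin => /negPf ->.
  have [e se eg] := agreement_out nT agr E sg.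
  have [|tS _ te] := agr_edge agr (e := e); first by rewrite se.
  have : tgt e = tgt e0'.
    by apply: (agr_inj agr) => //; [exact: full | rewrite -te eg tg].
  move/edge_inj_tgt => E'; move: E; rewrite -se E' s0'.
  by rewrite (negPf (agr_root agr)).
have h1 e : h (src e) = src (he e).
  rewrite /h /he; case: (eqVneq e e0') => [->|ne]; first by rewrite s0' eqxx.
  have eS := nE _ ne; have [_ -> _] := agr_edge agr eS.
  by move: eS; rewrite notin => /negPf ->.
have h2 e : h (tgt e) = tgt (he e).
  rewrite /h /he; case: (eqVneq e e0') => [->|ne]; first by rewrite (negPf c0).
  have [tS _ ->] := agr_edge agr (nE _ ne).
  by move: tS; rewrite notin => /negPf ->.
have h3 : h (root T') = root T by rewrite /h eqxx.
have h4 i : h (leaf T' i) = leaf T i.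
  have [lS le] := agr_leaf agr i; rewrite /h le.
  by move: lS; rewrite notin => /negPf ->.
apply: isomorphic_sym; exists (LMorph h1 h2 h3 h4); split; first by exists h'.
apply: inj_card_bij; last by rewrite ce.
move=> e f /= E; apply: edge_inj_tgt; apply: hi; by rewrite h2 E -h2.
Qed.

Lemma agreement_extend T S phi psi (x : vert T') :
  is_tree T -> @agreement T S phi psi -> x \notin S -> x != root T' ->
  exists T1 S1 phi1 psi1, [/\ is_tree T1, SNPR0 T T1,
    @agreement T1 S1 phi1 psi1 & #|S| < #|S1|].
Proof.
move=> tT agr xS xr.
have nT := networkP T; have nT' := networkP T'.
pose P y := (y \notin S) && (y != root T').
have {xS xr x}[x [xS xr child]] : exists x, [/\ x \notin S, x != root T' &
    forall e, src e = x -> tgt e \in S].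
  have Px : P x by rewrite /P xS xr.
  case: (arg_maxnP (@ancestors n T') Px) => y /andP[yS yr] my.
  exists y; split=> // e se; apply: contraT => tS.
  have : P (tgt e).
    rewrite /P tS; apply/eqP => E; have := indeg_gt0 e; rewrite E.
    by have /andP[/eqP -> _] := network_root nT'.
  have lt := ancestors_lt e (network_acyclic nT'); rewrite se in lt.
  by move/my => /(leq_trans lt); rewrite ltnn.
have /outdeg_gt1P[e1 [e2 [e12 s1 s2]]] : 1 < outdeg x.
  case: (vertex_kind x nT') => [[E _]|lx||rx].
  - by rewrite E eqxx in xr.
  - have [i E] := proj1 (network_leaf nT' x) lx.
    by move: xS; rewrite -E; have [-> _] := agr_leaf agr i.
  - by move=> /andP[_ /eqP ->].
  - by move: (treeT' x); rewrite rx.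
have aS := child _ s1; have bS := child _ s2.
have s12 : src e1 = src e2 by rewrite s1 s2.
have nc := agreement_siblings nT agr s12 e12 aS bS.
have /indeg_gt0P[e te] : 0 < indeg (phi (tgt e1)).
  by apply: network_indeg_gt0 => //; exact: (agreement_not_root nT agr).
have si : is_inner_tree_vertex (src e).
  case: (vertex_kind (src e) nT) => [[E _]|/andP[_ /eqP E]|//|rE].
  - case: (root_child_connect nT E (phi (tgt e2))).
      by move/(agreement_not_root nT agr bS).
    by rewrite te (negPf nc).
  - by have := outdeg_gt0 e; rewrite E.
  - by move: (tT (src e)); rewrite rE.
have [H [f [a0 [r re]]]] := graft_decomposition nT si.
have nA := is_network_giso (giso_sym r) nT.
have agrA := agreement_giso (giso_sym r) agr.
set phiA := (_ \o phi) in agrA; set psiA := (_ \o psi) in agrA.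
have phia : phiA (tgt e1) = Some a0.
  by rewrite /phiA /= -te -re gtgt gvK.
have phiN k : k \in S -> phiA k <> None.
  move=> kS E; have sN : src (None : edge (graft f a0)) = phiA k by rewrite E.
  have [e' se' eN] := agreement_out nA agrA kS sN.
  have [|tS _ te'] := agr_edge agrA (e := e'); first by rewrite se'.
  have : tgt e' = tgt e1 by apply: (agr_inj agrA) => //; rewrite -te' eN phia.
  by move/edge_inj_tgt => E1; move: kS; rewrite -se' E1 s1 (negPf xS).
case phib : (phiA (tgt e2)) => [b0|]; last by case: (phiN _ bS phib).
have ab : (a0 == b0) = false.
  apply/eqP => E; move/eqP: e12; apply; apply: edge_inj_tgt.
  by apply: (agr_inj agrA) => //; rewrite phia phib E.
have /indeg_gt0P[f2 tf2] : 0 < indeg b0.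
  have := network_indeg_gt0 nA (agreement_not_root nA agrA bS).
  by rewrite phib indeg_graft ab.
have ncH : ~~ connect (@adj n H) a0 (src f2).
  have := agreement_siblings nA agrA s12 e12 aS bS.
  apply: contra => c; rewrite phia phib connect_add_edge connect_subdivide.
  by rewrite -tf2 (connect_trans c (connect_edge f2)).
have nT1 := is_network_graft nA ncH.
pose T1 := Network nT1.
pose phi1 k : vert T1 := if k == x then None else phiA k.
pose psi1 g : edge T1 :=
  if g == e1 then None else if g == e2 then Some None else psiA g.
have xE k : k \in S -> (k == x) = false.
  by move=> kS; apply: contraTF kS => /eqP ->.
exists T1, (x |: S), phi1, psi1; split.
- apply/tree_reticulation_number.
  rewrite -(proj1 (tree_reticulation_number T) tT).
  by apply: reticulation_number_vert; rewrite -(card_vert_giso r).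
- apply/SNPR0P; exists H, f, f2, a0; split=> //; first exact: giso_isomorphic r.
  exact: isomorphic_refl.
- split.
  + by rewrite !inE negb_or eq_sym xr (agr_root agr).
  + move=> i; have [lS le] := agr_leaf agrA i.
    by rewrite !inE lS orbT /phi1 xE.
  + move=> g; rewrite !inE => /orP[/eqP sg|gS].
      rewrite /phi1 sg eqxx (xE _ (child _ sg)) (child _ sg) orbT; split=> //.
        rewrite /psi1; case: eqP => // n1; case: eqP => // n2.
        have : 2 < outdeg x.
          apply/card_gt2P; exists e1, e2, g; rewrite !inE s1 s2 sg eqxx.
          by split=> //; split=> //; apply/eqP => E; [case: n2 | case: n1].
        by rewrite ltnNge network_outdeg.
      rewrite /psi1; case: eqP => [->|n1]; first by rewrite phia.
      case: eqP => [->|n2]; first by rewrite phib /= tf2.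
      have : 2 < outdeg x.
        apply/card_gt2P; exists e1, e2, g; rewrite !inE s1 s2 sg eqxx.
        by split=> //; split=> //; apply/eqP => E; [case: n2 | case: n1].
      by rewrite ltnNge network_outdeg.
    have [tS sg tg] := agr_edge agrA gS.
    rewrite tS orbT /phi1 !xE // /psi1.
    have -> : (g == e1) = false by apply: contraTF gS => /eqP ->; rewrite s1.
    have ge2 : (g == e2) = false by apply: contraTF gS => /eqP ->; rewrite s2.
    rewrite ge2; split=> //.
    move: sg tg (phiN _ gS) (phiN _ tS).
    case E : (psiA g) => [[g0|]|] /=; [| by move=> <- | by move=> <-].
    move=> _; case: eqP => [_ <- //|_ tg _ _].
    case: eqP => [E2|_]; last exact: tg.
    case/eqP: (negbT ge2); apply: edge_inj_tgt; apply: (agr_inj agrA) => //.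
    by rewrite phib -tg E2 tf2.
  + move=> y z; rewrite !inE /phi1.
    case: (eqVneq y x) => [->|_]; case: (eqVneq z x) => [->|_] //=.
    * by move=> _ zS /esym /(phiN _ zS).
    * by move=> yS _ /(phiN _ yS).
    * exact: (agr_inj agrA).
- by rewrite cardsU1 xS.
Qed.

Lemma agreement_start T : exists phi psi,
  @agreement T [set v | is_leaf v] phi psi.
Proof.
have nT := networkP T; have nT' := networkP T'.
have /andP[_ /eqP o1] := network_root nT.
have /outdeg_gt0P[e0 _] : 0 < outdeg (root T) by rewrite o1.
pose phi x := if [pick i | leaf T' i == x] is Some i then leaf T i else root T.
have phiE i : phi (leaf T' i) = leaf T i.
  rewrite /phi; case: pickP => [j /eqP/(network_leaf_inj nT') -> //|/(_ i)].
  by rewrite eqxx.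
have leafP v : v \in [set v : vert T' | is_leaf v] -> exists i, v = leaf T' i.
  by rewrite inE => /(network_leaf nT')[i <-]; exists i.
exists phi, (fun=> e0); split.
- have /andP[/eqP i0 _] := network_root nT'; by rewrite inE /is_leaf i0.
- by move=> i; split=> //; rewrite inE; apply/(network_leaf nT'); exists i.
- move=> e; rewrite inE => /andP[_ /eqP o0].
  by have := outdeg_gt0 e; rewrite o0.
- move=> x y /leafP[i ->] /leafP[j ->]; rewrite !phiE.
  by move/(network_leaf_inj nT) ->.
Qed.

Lemma tree_space_connected T :
  is_tree T -> exists k, SNPR_sequence k T T'.
Proof.
move=> tT; have [phi [psi agr]] := agreement_start T.
move: [set v | _] agr => S agr.
have [m] := ubnP (#|vert T'| - #|S|).
elim: m T tT S phi psi agr => // m IH T tT S phi psi agr lm.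
case: (pickP (fun x => (x \notin S) && (x != root T'))) => [x /andP[xS xr]|full].
  have [T1 [S1 [phi1 [psi1 [tT1 s agr1 lt]]]]] := agreement_extend tT agr xS xr.
  have le := max_card (mem S1).
  have [|k sk] := IH _ tT1 _ _ _ agr1.
    by move: #|S1| #|S| #|vert T'| le lt lm => a b c; lia.
  by exists k.+1; apply: SNPR_sequenceS sk; exact: Or31.
exists 0; apply: SNPR_sequence0; apply: agreement_complete tT agr _ => k kr.
by have := full k; rewrite kr andbT => /negbFE.
Qed.

End TreeSpace.

Section Distance.

Variable n : nat.
Implicit Types (N T M : network n).

Lemma redirected_sequence T T' : isomorphic T T' \/ SNPR0 T T' ->
  exists2 k, k <= 1 & SNPR_sequence k T T'.
Proof.
case=> [i|s]; first by exists 0 => //; exact: SNPR_sequence0.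
by exists 1 => //; apply: SNPR_sequence1; exact: Or31.
Qed.

Lemma displayed_SNPR0 T N M : SNPR0 N M -> is_tree T -> flow T N ->
  exists T', [/\ is_tree T', inhabited (flow T' M) &
    isomorphic T T' \/ SNPR0 T T'].
Proof.
case/SNPR0P => H [f [f' [v [/isomorphicP[i] /isomorphicP[j] nc]]]] tT p.
case: (eqVneq f f') => [ff|ff].
  subst f'; exists T; split=> //; last by left; exact: isomorphic_refl.
  by split; exact: flow_comp p (flow_comp (flow_giso (giso_sym i)) (flow_giso j)).
have nA := is_network_giso (giso_sym i) (networkP N).
have [_ ncf] := proj1 (acyclic_graft f v) (network_acyclic nA).
pose g : edge (@subdivide n (graft f v) None) := Some (Some (Some f')).
have nQ : is_network (double_graft g).
  apply/is_network_add_reticulation; split=> //.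
  rewrite /edge_descendant [src _]/= connect_subdivide_NS.
  rewrite connect_add_edge connect_subdivide (negPf nc) connect_subdivide_SN.
  by rewrite (negPf ncf).
pose Q := Network nQ.
pose p' : flow T Q := flow_comp (flow_comp p (flow_giso (giso_sym i)))
  (flow_add_reticulation g).
have rQ := retic_add_reticulation g.
have [] := @redirect _ _ _ p' (Some (Some (Some None))) None tT rQ erefl isT.
move=> T' [tT' [q qe] rel].
exists T'; split=> //.
pose s := giso_swap v ff.
have [|r] := @flow_add_reticulation_restrict _ _ _ _ _
  (flow_comp q (flow_giso s)) (networkP T').
  by rewrite -qe; apply: flow_compE; exact: (flow_gisoE s (Some (Some (Some None)))).
by split; exact: flow_comp r (flow_giso j).
Qed.

Lemma displayed_SNPRminus T N M : SNPRminus N M -> is_tree T -> flow T N ->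
  exists T', [/\ is_tree T', inhabited (flow T' M) &
    isomorphic T T' \/ SNPR0 T T'].
Proof.
case/SNPRminusP/SNPRplusP => e [f /isomorphicP[i]] tT p.
have nQ := is_network_giso (giso_sym i) (networkP N).
pose Q := Network nQ.
have rQ : @is_reticulation n Q (tgt (None : edge Q)) := retic_add_reticulation f.
have /indeg_gt1P[a [b [ab ta tb]]] : 1 < indeg (tgt (None : edge Q)).
  by case/andP: rQ => /eqP ->.
have [c tc nc] : exists2 c, tgt c = tgt (None : edge Q) & None != c.
  case: (eqVneq a None) => [E|na]; last by exists a => //; rewrite eq_sym.
  by exists b => //; rewrite -E.
have [T' [tT' [q qe] rel]] :=
  @redirect _ _ Q (flow_comp p (flow_giso (giso_sym i))) None c tT rQ tc nc.
exists T'; split=> //.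
exact: flow_add_reticulation_restrict (networkP T') qe.
Qed.

Lemma displayed_SNPR T N M : SNPR N M -> is_tree T -> flow T N ->
  exists T' k, [/\ is_tree T', inhabited (flow T' M), SNPR_sequence k T T' &
    k + reticulation_number M <= (reticulation_number N).+1].
Proof.
case=> s tT p.
- have [T' [tT' pT' /redirected_sequence[k k1 sk]]] := displayed_SNPR0 s tT p.
  exists T', k; split=> //.
  case/SNPR0P: s => H [f [f' [v [/isomorphicP[i] /isomorphicP[j] _]]]].
  suff -> : reticulation_number M = reticulation_number N by lia.
  by apply: reticulation_number_vert; rewrite -(card_vert_giso i) -(card_vert_giso j).
- case/SNPRplusP: s => e [f /isomorphicP[i]].
  exists T, 0; split=> //.
  + by split; exact: flow_comp p (flow_comp (flow_add_reticulation f) (flow_giso i)).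
  + exact/SNPR_sequence0/isomorphic_refl.
  + by rewrite (reticulation_number_add i).
- have [T' [tT' pT' /redirected_sequence[k k1 sk]]] := displayed_SNPRminus s tT p.
  exists T', k; split=> //.
  case/SNPRminusP/SNPRplusP: s => e [f /isomorphicP[i]].
  by rewrite (reticulation_number_add i); lia.
Qed.

Lemma displayed_sequence k N M T : SNPR_sequence k N M -> is_tree T -> flow T N ->
  exists T' l, [/\ is_tree T', inhabited (flow T' M), SNPR_sequence l T T' &
    l + reticulation_number M <= k + reticulation_number N].
Proof.
move=> s; elim: s T => [{}N {}M /isomorphicP[i] T tT p|{}k {}N P {}M s _ IH T tT p].
  exists T, 0; split=> //.
  - by split; exact: flow_comp p (flow_giso i).
  - exact/SNPR_sequence0/isomorphic_refl.
  - suff -> : reticulation_number M = reticulation_number N by [].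
    by apply: reticulation_number_vert; rewrite -(card_vert_giso i).
have [T1 [l1 [tT1 [p1] s1 le1]]] := displayed_SNPR s tT p.
have [T2 [l2 [tT2 p2 s2 le2]]] := IH _ tT1 p1.
exists T2, (l1 + l2); split=> //; first exact: SNPR_sequence_cat s1 s2.
lia.
Qed.

Lemma displayed_to_network T N : is_tree T -> flow T N ->
  SNPR_sequence (reticulation_number N) T N.
Proof.
move=> tT; move Er : (reticulation_number N) => r.
elim: r N Er => [|r IH] N Er p.
  apply: SNPR_sequence0; apply: tree_flow_iso p => //.
  exact/tree_reticulation_number.
have [v rv] : exists v : vert N, is_reticulation v.
  have : 0 < reticulation_number N by rewrite Er.
  by move/card_gt0P => [v]; rewrite inE; exists v.
have [w rw hw] := highest_vertex (network_acyclic (networkP N)) rv.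
have /indeg_gt1P[a [b [ab ta tb]]] : 1 < indeg w by case/andP: rw => /eqP ->.
have ra : is_reticulation (tgt a) by rewrite ta.
have [e te ce] : exists2 e, tgt e = w & fc p e = None.
  case: (uncoloured_in_edge p tT ra _ ab) => [|c|c]; first by rewrite tb.
    by exists a.
  by exists b.
have re : is_reticulation (tgt e) by rewrite te.
have si := retic_parent_inner (networkP N) re (hw _ te).
have [N' [d [f [q [_ [p']]]]]] := remove_edge si re ce.
rewrite -addn1; apply: (@SNPR_sequence_cat _ _ _ _ N').
  by apply: IH p'; move: Er; rewrite (reticulation_number_add q) => -[].
apply: SNPR_sequence1; apply: Or32; apply/SNPRplusP; exists d, f.
exact: giso_isomorphic.
Qed.

Lemma exists_minimum (P : nat -> Prop) k : P k -> exists m, is_minimum P m.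
Proof.
have [j] := ubnP k; elim: j k => // j IH k lk Pk.
case: (classic (exists2 i, P i & i < k)) => [[i Pi ik]|no].
  by apply: (IH i) => //; lia.
exists k; split=> // i Pi; rewrite leqNgt; apply/negP => ik.
by apply: no; exists i.
Qed.

End Distance.

Theorem theorem3p6 (n : nat) (T N : network n) (r : nat)
    (hT : is_tree T) (hr : reticulation_number N = r) :
  exists d m : nat,
    [/\ is_SNPR_distance T N d,
        is_minimum (fun k => exists T' : network n,
          displays N T' /\ is_SNPR_distance T T' k) m &
        d = m + r].
Proof.
have dispP T' : displays N T' <-> is_tree T' /\ inhabited (flow T' N).
  have E := embedding_flow (networkP T') (networkP N).
  by rewrite /displays; split=> -[h1 h2]; split=> //; apply/E.
have [T0 tT0 p0] := exists_displayed N.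
have [k0 s0] := tree_space_connected tT0 hT.
have [d0 dist0] : exists d, is_SNPR_distance T T0 d by exact: exists_minimum s0.
have [m mmin] : exists m, is_minimum (fun k => exists T' : network n,
    displays N T' /\ is_SNPR_distance T T' k) m.
  by apply: (@exists_minimum _ d0); exists T0; split=> //; apply/dispP.
exists (m + r), m; split=> //.
case: mmin => -[T1 [/dispP[tT1 [p1]] [s1 _]]] mmin; split.
  by rewrite -hr; apply: SNPR_sequence_cat s1 (displayed_to_network tT1 p1).
move=> k s; have p : flow T T := flow_giso (giso_refl T).
have [T2 [l [tT2 p2 s2]]] := displayed_sequence s hT p.
rewrite hr (proj1 (tree_reticulation_number T) hT) addn0.
have [d2 dist2] : exists d, is_SNPR_distance T T2 d by exact: exists_minimum s2.
have : m <= d2 by apply: mmin; exists T2; split=> //; apply/dispP.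
by have := proj2 dist2 _ s2; lia.
Qed.
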